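(* If $H$ is a $3$-graph with maximum degree at most $\Delta$, then $$\mathrm{ex}(H,\mathcal{C}_3^3)\ge \Delta^{-1/2-o(1)}\cdot e(H),\qquad \mathrm{ex}(H,\mathcal{C}_4^3)\ge \Delta^{-3/4-o(1)}\cdot e(H).$$ If $H$ is a $4$-graph with maximum degree at most $\Delta$, then $$\mathrm{ex}(H,\mathcal{C}_4^4)\ge \Delta^{-5/6-o(1)}\cdot e(H).$$
   Context: An $r$-graph is an $r$-uniform hypergraph; $e(H)$ is its number of edges; the maximum degree is the maximum number of edges containing a given vertex. For a family $\mathcal{F}$ of $r$-graphs, $\mathrm{ex}(H,\mathcal{F})$ is the maximum number of edges in a subgraph of $H$ containing no subgraph isomorphic to a member of $\mathcal{F}$. $\mathcal{C}_\ell^r$ is the set of all $r$-uniform Berge $\ell$-cycles: $r$-graphs with exactly $\ell$ distinct edges $e_1,\dots,e_\ell$ for which there are distinct vertices $v_1,\dots,v_\ell$ with $v_i,v_{i+1}\in e_i$ for $1\le i<\ell$ and $v_\ell,v_1\in e_\ell$. Asymptotics are as $\Delta\to\infty$: each bound means that for every $\varepsilon>0$ there is $\Delta_0$ such that for all $\Delta\ge\Delta_0$ and all $H$ with maximum degree at most $\Delta$ the inequality holds with $o(1)$ replaced by $\varepsilon$. *)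

(* Defs.v *)
From HB Require Import structures.
From mathcomp Require Import all_boot all_order all_algebra.
From mathcomp Require Import boolp reals exp.

Set Implicit Arguments.
Unset Strict Implicit.
Unset Printing Implicit Defensive.

(* Plain MathComp finite combinatorics; boolp is used only to take a maximum
   over a Prop-valued condition, and reals/exp only for real powers. *)

Definition is_unigraph (r : nat) (T : finType) (G : {set T} * {set {set T}}) : bool :=
  [forall e in G.2, (#|e| == r) && (e \subset G.1)].

(* The vertex set is a subset of an ambient finite type, so that subgraphs (with
   possibly fewer vertices) are again r-graphs over the same type. *)
Record unigraph (r : nat) (T : finType) := UniGraph {
  unigraph_val : {set T} * {set {set T}};
  unigraph_valP : is_unigraph r unigraph_val
}.

HB.instance Definition _ r T := [isSub for @unigraph_val r T].
HB.instance Definition _ r T := [Finite of unigraph r T by <:].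

Definition vertices r T (G : unigraph r T) : {set T} := (unigraph_val G).1.
Definition edges r T (G : unigraph r T) : {set {set T}} := (unigraph_val G).2.

Definition degree r T (G : unigraph r T) (x : T) : nat :=
  #|[set e in edges G | x \in e]|.

Definition max_degree r T (G : unigraph r T) : nat :=
  \max_(x in vertices G) degree G x.

Definition subgraph r T (G H : unigraph r T) : bool :=
  (vertices G \subset vertices H) && (edges G \subset edges H).

(* [f] matters only on the vertices of G.  Totality of [f] is a restriction only
   when T' is empty and T is not, so only between graphs without vertices. *)
Definition isomorphic r T T' (G : unigraph r T) (G' : unigraph r T') : Prop :=
  exists f : T -> T',
    [/\ {in vertices G &, injective f},
        f @: vertices G = vertices G'
      & [set f @: (e : {set T}) | e in edges G] = edges G'].

Definition gfamily (r : nat) := forall T : finType, unigraph r T -> Prop.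

Definition family_free r (F : gfamily r) T (G : unigraph r T) : Prop :=
  forall (T' : finType) (A : unigraph r T') (K : unigraph r T),
    F T' A -> subgraph K G -> ~ isomorphic K A.

(* ex(H, F) *)
Definition ex_number r T (H : unigraph r T) (F : gfamily r) : nat :=
  \max_(G : unigraph r T | subgraph G H && `[< family_free F G >]) #|edges G|.

(* [ordS i] is the cyclic successor of [i] in ['I_l].  [v i] is automatically a
   vertex of G, being in an edge.  Isolated vertices are not excluded; this does
   not affect [family_free], where subgraphs may have any vertex set. *)
Definition berge_cycle (l r : nat) : gfamily r := fun T G =>
  exists (e : 'I_l -> {set T}) (v : 'I_l -> T),
    [/\ injective e,
        edges G = [set e i | i : 'I_l],
        injective v
      & forall i : 'I_l, v i \in e i /\ v (ordS i) \in e i].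

Arguments berge_cycle l r T G : clear implicits.

(* Main.v *)
(* Let [J] be an r-partite r-graph of Ruzsa-Szemeredi type: its edges are the lines
   [i |-> y + slope i * phi a] with [y] in an abelian group and [a] in a Behrend set
   [A] of a finite field of fixed characteristic [p], which has [q ^ (1 - o(1))]
   elements of the field of order [q].  With [phi a = a] there is no Berge triangle
   and about [Q ^ 2] edges on [Q = q] points; with [phi a = (a, a ^ 2)] there is no
   Berge cycle of length at most four and about [Q ^ (3 / 2)] edges on
   [Q = q ^ 2] points.

   Given [H] of maximum degree [s ^ (r - 1)], take [Q] a large multiple of [s].  If all
   codegrees are small (a set of [j] vertices lies in at most [s ^ (r - j)] edges), map
   [V(H)] to [J] at random, keep the edges landing on edges of [J] and delete those
   that clash with a neighbour: a fraction [#|J| / Q ^ r] survives, and the map is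
   locally injective on edges, so Berge cycles of the surviving graph would give Berge
   cycles in [J].  Sets of large codegree are contracted: fix, for a constant fraction
   of the edges, a common partition of the [r] parts into blocks, as coarse as
   possible subject to each block of the edge being heavy.  Unions of blocks are then
   light by minimality.  The edges through a heavy set are cut into chunks of the
   critical size, and a chunk is selected as a single vertex with the appropriate
   probability.  All exponents balance, so the same fraction survives as in the light
   case. *)

Require Import Defs.
From HB Require Import structures.
From mathcomp Require Import all_boot all_order all_algebra all_field.
From mathcomp Require Import boolp reals exp.
From mathcomp Require Import ring lra zify.
Set Implicit Arguments.
Unset Strict Implicit.
Unset Printing Implicit Defensive.

(** * Counting *)

(** Every function on [I] extends along [z] in the same number of ways, the values off the image
    being free. All probabilities of label events below come from this count. *)
Lemma card_ffun_restrict (I Z X : finType) (z : I -> Z) (B : {set {ffun I -> X}}) :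
  injective z ->
  #|[set chi : {ffun Z -> X} | [ffun i => chi (z i)] \in B]| * #|X| ^ #|I| = #|B| * #|X| ^ #|Z|.
Proof.
move=> z_inj.
have fiber (b : {ffun I -> X}) :
    #|[set chi : {ffun Z -> X} | [ffun i => chi (z i)] == b]| * #|X| ^ #|I| = #|X| ^ #|Z|.
  pose F (w : Z) : pred X := if [pick i | z i == w] is Some i then pred1 (b i) else predT.
  have -> : #|[set chi : {ffun Z -> X} | [ffun i => chi (z i)] == b]| =
      #|(family F : simpl_pred {dffun Z -> X})|.
    apply: eq_card => chi; rewrite inE; apply/eqP/familyP => [E w|H].
      by rewrite /F -E; case: pickP => // i /eqP <-; rewrite inE /= ffunE.
    apply/ffunP => i; rewrite ffunE; have := H (z i); rewrite /F.
    case: pickP => [j /eqP/z_inj ->|/(_ i)].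
      by move/eqP.
    by rewrite eqxx.
  rewrite card_family foldrE big_map big_enum /=.
  have -> : #|X| ^ #|I| = \prod_(w : Z) (if [pick i | z i == w] is Some i then #|X| else 1).
    rewrite -prod_nat_const -(big_imset (fun=> #|X|) (h := z)); last first.
      by move=> ? ? _ _; exact: z_inj.
    rewrite big_mkcond /=; apply: eq_bigr => w _; case: pickP => [i /eqP <-|H].
      by rewrite imset_f.
    by case: imsetP => // -[i _ E]; have := H i; rewrite -E eqxx.
  rewrite -big_split /= -prod_nat_const; apply: eq_bigr => w _.
  by rewrite /F; case: pickP => [i _|_]; rewrite ?card1 ?mul1n ?muln1.
pose restr (chi : {ffun Z -> X}) := [ffun i => chi (z i)].
rewrite -sum1_card (partition_big restr (mem B)) /=; last first.
  by move=> chi; rewrite inE.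
rewrite big_distrl /= -sum_nat_const; apply: eq_bigr => b bB.
rewrite -(fiber b); congr (_ * _); rewrite -sum1_card; apply: eq_bigl => chi.
by rewrite !inE /restr; case: eqP => [->|]; rewrite ?bB ?andbF.
Qed.

(** First-moment method in counting form: double counting the pairs with [P w e] shows that some
    outcome does at least as well as the mean. *)
Lemma averaging (Om D : finType) (E : {set D}) (P : Om -> pred D) (m k : nat) :
  0 < #|Om| -> (forall e, e \in E -> m * #|Om| <= k * #|[set w | P w e]|) ->
  exists w, m * #|E| <= k * #|[set e in E | P w e]|.
Proof.
move=> Om_gt0 H; have [/existsP//|/existsPn N] :=
  boolP [exists w, m * #|E| <= k * #|[set e in E | P w e]|].
exfalso.
have E_gt0 : 0 < m * #|E|.
  by have /card_gt0P[w _] := Om_gt0; have := N w; rewrite -ltnNge; apply: leq_ltn_trans.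
have U : \sum_(w : Om) k * #|[set e in E | P w e]| <= #|Om| * (m * #|E|).-1.
  rewrite -sum_nat_const; apply: leq_sum => w _; have := N w; rewrite -ltnNge; lia.
have L : #|Om| * (m * #|E|) <= \sum_(w : Om) k * #|[set e in E | P w e]|.
  rewrite -big_distrr /=.
  have -> : \sum_(w : Om) #|[set e in E | P w e]| = \sum_(e in E) #|[set w | P w e]|.
    transitivity (\sum_(w : Om) \sum_(e in E) (P w e : nat)).
      apply: eq_bigr => w _; rewrite -sum1_card big_mkcond [RHS]big_mkcond; apply: eq_bigr => e _.
      by rewrite inE; case: (e \in E); case: (P w e).
    rewrite exchange_big /=; apply: eq_bigr => e _; rewrite -sum1_card [RHS]big_mkcond /=.
    by apply: eq_bigr => w _; rewrite inE; case: (P w e).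
  rewrite big_distrr /= mulnC (mulnC m) -mulnA -sum_nat_const; apply: leq_sum => e eE.
  exact: H.
nia.
Qed.

(** Pieces of size [th] are split off until at most [2 * th] elements remain, which form the last
    chunk. The value [g e] represents the chunk of [e]. *)
Lemma chunking (D : finType) (th : nat) (S : {set D}) : 0 < th ->
  exists g : D -> D,
    [/\ forall e, e \in S -> g e \in S,
        forall e, e \in S -> #|[set f in S | g f == g e]| <= 2 * th,
        th <= #|S| -> forall e, e \in S -> th <= #|[set f in S | g f == g e]|
      & #|S| <= th -> {in S &, forall e f, g e = g f}].
Proof.
move=> th_gt0; have [n] := ubnP #|S|; elim: n S => // n IHn S.
rewrite ltnS => Sn.
have [small|big] := leqP #|S| (2 * th).
  have [->|[x0 x0S]] := set_0Vmem S.
    by exists id; split=> [e|e|_ e|_ e f]; rewrite inE.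
  have S' : [set f in S | x0 == x0] = S by apply/setP => f; rewrite inE eqxx andbT.
  by exists (fun=> x0); split=> //; rewrite S'.
have [P PS cP] : exists2 P : {set D}, P \subset S & #|P| = th.
  have : 0 < #|[set P : {set D} | (P \subset S) && (#|P| == th)]|.
    by rewrite cards_draws bin_gt0; lia.
  by case/card_gt0P => P; rewrite inE => /andP[PS /eqP]; exists P.
have [x0 x0P] : exists x0, x0 \in P by apply/card_gt0P; rewrite cP.
have cSP : #|S :\: P| = #|S| - th by rewrite cardsDS // cP.
have [|g [gS gle gge _]] := IHn (S :\: P); first by lia.
(* [x0] lies in [P], while [g] maps [S :\: P] to itself, so the new chunk stays apart from the
   others. *)
pose g' e := if e \in P then x0 else g e.
have g'P e : e \in S -> [set f in S | g' f == g' e] =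
    if e \in P then P else [set f in S :\: P | g f == g e].
  move=> eS; rewrite /g'; case: ifP => eP; apply/setP => f; rewrite !inE.
    case: ifP => fP; first by rewrite eqxx andbT (subsetP PS).
    case fS: (f \in S) => //=; apply/negP => /eqP gf.
    by have := gS f; rewrite inE fS fP gf inE x0P => /(_ isT).
  case: ifP => fP /=.
    rewrite andbC; apply/negP => /andP[/eqP gf _].
    by have := gS e; rewrite inE eS eP -gf inE x0P => /(_ isT).
  by [].
exists g'; split=> [e eS|e eS|_ e eS|]; last by lia.
- rewrite /g'; case: ifP => eP; first exact: (subsetP PS).
  by have := gS e; rewrite !inE eP eS => /(_ isT) /andP[].
- by rewrite g'P //; case: ifP => eP; [rewrite cP; lia | apply: gle; rewrite inE eP].
- rewrite g'P //; case: ifP => eP; first by rewrite cP.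
  by apply: gge; [lia | rewrite inE eP].
Qed.

(** * Random labels and deletion of conflicts *)

Section Alteration.
Variables (r : nat) (D W X : finType) (V : 'I_r -> D -> W) (J : {set {ffun 'I_r -> X}}).
Implicit Types (chi : {ffun 'I_r * W -> X}) (e f : D) (w : W) (P : {set 'I_r}).

Definition edge_image chi e : {ffun 'I_r -> X} := [ffun i => chi (i, V i e)].

(* A unit is selected for its block [P] when its labels agree on [P]; this has
   probability [#|X| ^ (1 - #|P|)], and a selected unit gets a uniform label. *)
Definition constant_on chi w P : bool :=
  [forall i in P, forall j in P, chi (i, w) == chi (j, w)].

Definition differ e f : {set 'I_r} := [set i | V i f != V i e].

Lemma card_alive e :
  #|[set chi | edge_image chi e \in J]| * #|X| ^ r = #|J| * #|X| ^ #|{: 'I_r * W}|.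
Proof.
have z_inj : injective (fun i : 'I_r => (i, V i e)) by move=> i j [].
by have := card_ffun_restrict J z_inj; rewrite card_ord.
Qed.

(** Only the labels of [f] at coordinates in [differ e f] are fresh; each must hit a prescribed
    value, at the cost of one factor [#|X|]. *)
Lemma card_same_image e f :
  #|[set chi | (edge_image chi e \in J) && (edge_image chi f == edge_image chi e)]|
    * #|X| ^ (r + #|differ e f|) = #|J| * #|X| ^ #|{: 'I_r * W}|.
Proof.
pose I := ('I_r + {i | i \in differ e f})%type.
pose z (s : I) : 'I_r * W :=
  match s with inl i => (i, V i e) | inr i => (val i, V (val i) f) end.
pose h (s : I) : 'I_r := match s with inl i => i | inr i => val i end.
have z_inj : injective z.
  move=> [i|i] [j|j] //= [E1]; rewrite ?E1 //.
  - by move=> E; have := valP j; rewrite inE /= E eqxx.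
  - by move=> E; have := valP i; rewrite inE /= E1 E eqxx.
  - by move=> _; congr inr; apply: val_inj.
pose B := [set [ffun s : I => E (h s)] | E : {ffun 'I_r -> X} in J].
have cB : #|B| = #|J|.
  apply: card_imset => E E' /ffunP H; apply/ffunP => i.
  by have := H (inl i); rewrite !ffunE.
have cI : #|{: I}| = r + #|differ e f| by rewrite card_sum card_ord card_sig.
rewrite -cI -cB -(card_ffun_restrict B z_inj); congr (_ * _); apply: eq_card => chi.
rewrite !inE; apply/andP/imsetP => [[eJ /eqP fe]|[E EJ /ffunP H]].
  exists (edge_image chi e) => //; apply/ffunP => -[i|i]; rewrite !ffunE //=.
  by move/ffunP: fe => /(_ (val i)); rewrite !ffunE.
have imE : edge_image chi e = E.
  by apply/ffunP => i; have := H (inl i); rewrite !ffunE.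
rewrite imE; split=> //; apply/eqP/ffunP => i; rewrite !ffunE.
case: (boolP (i \in differ e f)) => [id|].
  by have := H (inr (Sub i id)); rewrite !ffunE.
by rewrite inE negbK => /eqP->; rewrite -imE ffunE.
Qed.

(** The labels of [w] on [P] are independent of those read by [e]. Their common value, read off at
    [i0], is free and gives the extra factor [#|X|]. *)
Lemma card_constant_on e w P (i0 : 'I_r) : i0 \in P -> (forall i, i \in P -> V i e != w) ->
  #|[set chi | (edge_image chi e \in J) && constant_on chi w P]|
    * #|X| ^ (r + #|P|) = #|J| * #|X| * #|X| ^ #|{: 'I_r * W}|.
Proof.
move=> i0P wP.
pose I := ('I_r + {i | i \in P})%type.
pose z (s : I) : 'I_r * W := match s with inl i => (i, V i e) | inr i => (val i, w) end.
have z_inj : injective z.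
  move=> [i|i] [j|j] //= [E1]; rewrite ?E1 //.
  - by move=> E; have := wP _ (valP j); rewrite /= E eqxx.
  - by move=> E; have := wP _ (valP i); rewrite /= E1 E eqxx.
  - by congr inr; apply: val_inj.
pose B := [set [ffun s : I => match s with inl i => (E : {ffun 'I_r -> X}) i | inr _ => x end]
  | E in J, x in [set: X]].
have cB : #|B| = #|J| * #|X|.
  rewrite /B curry_imset2X card_imset ?cardsX ?cardsT // => -[E x] [E' x'] /= /ffunP H.
  congr (_, _); last by have := H (inr (Sub i0 i0P)); rewrite !ffunE.
  by apply/ffunP => i; have := H (inl i); rewrite !ffunE.
have cI : #|{: I}| = r + #|P| by rewrite card_sum card_ord card_sig.
rewrite -cI -cB -(card_ffun_restrict B z_inj); congr (_ * _); apply: eq_card => chi.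
rewrite !inE; apply/andP/imset2P => [[eJ cw]|[E x EJ _ /ffunP H]].
  exists (edge_image chi e) (chi (i0, w)) => //; apply/ffunP => -[i|i]; rewrite !ffunE //=.
  by apply/eqP; move/forall_inP: cw => /(_ _ (valP i)) /forall_inP/(_ _ i0P).
have imE : edge_image chi e = E.
  by apply/ffunP => i; have := H (inl i); rewrite !ffunE.
rewrite imE; split=> //; apply/forall_inP => i iP; apply/forall_inP => j jP.
have := H (inr (Sub i iP)); have := H (inr (Sub j jP)).
by rewrite !ffunE /= => -> ->.
Qed.

Variables (E : {set D}) (C2 : D -> {set D}) (C1 : D -> {set W * 'I_r}) (P : 'I_r -> {set 'I_r}).
Hypothesis P_refl : forall i, i \in P i.
Hypothesis C1_new : forall e u j, e \in E -> u \in C1 e -> j \in P u.2 -> V j e != u.1.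

(** [C2 e] holds competing edges; [C1 e] holds competing units, each with a coordinate that names
    its block. *)
Definition survives chi e : bool :=
  [&& edge_image chi e \in J, [forall f in C2 e, edge_image chi f != edge_image chi e]
    & [forall u in C1 e, ~~ constant_on chi u.1 (P u.2)]].

(** Union bound: given that the tuple of [e] lies in [J], the expected number of conflicts is at
    most one half. So [e] survives with probability at least half of [#|J| / #|X| ^ r], and
    averaging over [chi] applies. *)
Lemma alteration :
    0 < #|X| ->
    (forall e, e \in E -> 2 * (\sum_(f in C2 e) #|X| ^ (r - #|differ e f|)
        + \sum_(u in C1 e) #|X| ^ (r + 1 - #|P u.2|)) <= #|X| ^ r) ->
  exists chi, #|J| * #|E| <= 2 * #|X| ^ r * #|[set e in E | survives chi e]|.
Proof.
move=> X_gt0 few; apply: averaging; first by rewrite card_ffun expn_gt0 X_gt0.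
move=> e eE; rewrite card_ffun; have {few} := few e eE.
set S2 := \sum_(f in C2 e) _; set S1 := \sum_(u in C1 e) _.
set N := _ ^ #|_|; set q := #|X| => few.
pose same f := #|[set chi | (edge_image chi e \in J) && (edge_image chi f == edge_image chi e)]|.
pose const u := #|[set chi | (edge_image chi e \in J) && constant_on chi u.1 (P u.2)]|.
have union : #|[set chi | edge_image chi e \in J]| <=
    #|[set chi | survives chi e]| + (\sum_(f in C2 e) same f + \sum_(u in C1 e) const u).
  have cardE (p : pred {ffun 'I_r * W -> X}) : #|[set chi | p chi]| = \sum_chi p chi.
    by rewrite -sum1_card big_mkcond; apply: eq_bigr => chi _; rewrite inE; case: (p chi).
  have -> : \sum_(f in C2 e) same f = \sum_(f in C2 e) \sum_chi
      ((edge_image chi e \in J) && (edge_image chi f == edge_image chi e)).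
    by apply: eq_bigr => f _; exact: cardE.
  have -> : \sum_(u in C1 e) const u = \sum_(u in C1 e) \sum_chi
      ((edge_image chi e \in J) && constant_on chi u.1 (P u.2)).
    by apply: eq_bigr => u _; exact: cardE.
  rewrite !cardE.
  rewrite exchange_big /= [X in _ + (_ + X)]exchange_big /= -!big_split /=.
  have survE chi : (edge_image chi e \in J) <= survives chi e +
      (\sum_(f in C2 e) ((edge_image chi e \in J) && (edge_image chi f == edge_image chi e))
      + \sum_(u in C1 e) ((edge_image chi e \in J) && constant_on chi u.1 (P u.2))).
    rewrite /survives; case: (edge_image chi e \in J) => //=.
    have [_|/forall_inPn[f fC2]] :=
        boolP [forall f in C2 e, edge_image chi f != edge_image chi e]; last first.
      by rewrite negbK => H; rewrite (bigD1 f) //= H; lia.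
    have [_|/forall_inPn[u uC1]] :=
      boolP [forall u in C1 e, ~~ constant_on chi u.1 (P u.2)]; first by [].
    by rewrite negbK => H; rewrite [\sum_(u in C1 e) _](bigD1 u) //= H; lia.
  exact: (leq_sum _ (fun chi _ => survE chi)).
have alive : _ = _ * N := card_alive e.
have sameE f : same f * (q ^ r * q ^ r) = #|J| * N * q ^ (r - #|differ e f|).
  have le_r : #|differ e f| <= r by rewrite -[leqRHS]card_ord max_card.
  rewrite -(card_same_image e f) -mulnA -!expnD; congr (_ * _ ^ _); lia.
have constE u : u \in C1 e -> const u * (q ^ r * q ^ r) = #|J| * N * q ^ (r + 1 - #|P u.2|).
  move=> uC1; have le_r : #|P u.2| <= r by rewrite -[leqRHS]card_ord max_card.
  have E1 : q ^ r * q ^ r = q ^ (r + #|P u.2|) * q ^ (r - #|P u.2|).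
    by rewrite -!expnD; congr (_ ^ _); lia.
  rewrite E1 mulnA (card_constant_on (P_refl u.2)); last by move=> i; apply: C1_new.
  by rewrite addnC -addnBA // expnD expn1 -/N -/q; lia.
have r_gt0 : 0 < q ^ r by rewrite expn_gt0 X_gt0.
have S2E : (\sum_(f in C2 e) same f) * (q ^ r * q ^ r) = #|J| * N * S2.
  by rewrite /S2 big_distrl big_distrr /=; apply: eq_bigr.
have S1E : (\sum_(u in C1 e) const u) * (q ^ r * q ^ r) = #|J| * N * S1.
  by rewrite /S1 big_distrl big_distrr /=; apply: eq_bigr.
rewrite -(leq_pmul2r r_gt0); rewrite -/q in alive.
have := leq_mul union (leqnn (q ^ r * q ^ r)).
rewrite !mulnDl S2E S1E mulnA alive => U.
have := leq_mul (leqnn (#|J| * N)) few; lia.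
Qed.

End Alteration.

(** * Contracting heavy sets *)

Lemma leq_expn_base (m n k : nat) : m <= n -> m ^ k <= n ^ k.
Proof. by case: k => // k; rewrite leq_exp2r. Qed.

Lemma leq_card_bigcup (I S : finType) (e : {set I}) (N : I -> {set S}) (A : {set S}) :
  A \subset \bigcup_(v in e) N v -> #|A| <= \sum_(v in e) #|N v|.
Proof.
move=> AN; apply: leq_trans (subset_leq_card AN) _.
elim/big_rec2: _ => [|v n B _ IH]; first by rewrite cards0.
by apply: leq_trans (leq_card_setU _ _) _; rewrite leq_add2l.
Qed.

Section Units.
Variables (T : finType) (r s : nat) (pi : T -> 'I_r) (E : {set {set T}}).
Hypotheses (r_gt1 : 1 < r) (s_gt0 : 0 < s).
Hypothesis pi_onto : forall e, e \in E -> pi @: e = setT.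
Hypothesis pi_inj : forall e, e \in E -> {in e &, injective pi}.
Hypothesis degE : forall v, #|[set e in E | v \in e]| <= s ^ (r - 1).
Implicit Types (e f S : {set T}) (B : {set 'I_r}) (b : {ffun 'I_r -> 'I_r}).

Definition part e B : {set T} := [set v in e | pi v \in B].

Definition codegree S : nat := #|[set e in E | S \subset e]|.

Definition heavy e B : bool := s ^ (r - #|B|) <= codegree (part e B).

Definition block b (i : 'I_r) : {set 'I_r} := [set j | b j == b i].

(** A partition of the parts is encoded by the fibres of [b]. A single block would send whole edges
    to one part, so at least two are required. *)
Definition valid e b : bool :=
  (1 < #|b @: setT|) && [forall i, (1 < #|block b i|) ==> heavy e (block b i)].

Lemma block_refl b i : i \in block b i. Proof. by rewrite inE. Qed.

Lemma part_sub e B : part e B \subset e.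
Proof. by apply/subsetP => v; rewrite inE => /andP[]. Qed.

Lemma card_part e B : e \in E -> #|part e B| = #|B|.
Proof.
move=> eE; rewrite -(card_in_imset (f := pi)); last first.
  by move=> u v /(subsetP (part_sub _ _)) ue /(subsetP (part_sub _ _)) ve; exact: (pi_inj eE).
apply: eq_card => i; apply/imsetP/idP => [[v]|iB]; first by rewrite inE => /andP[_ vB] ->.
have : i \in pi @: e by rewrite pi_onto.
by case/imsetP => v ve iv; exists v; rewrite // inE ve -iv.
Qed.

Lemma card_edge e : e \in E -> #|e| = r.
Proof.
move=> eE; rewrite -[RHS]card_ord -cardsT -(card_part setT eE); apply: eq_card => v.
by rewrite !inE andbT.
Qed.

Lemma part_eq e f B : e \in E -> f \in E -> part e B \subset f -> part f B = part e B.
Proof.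
move=> eE fE sub; apply/eqP; rewrite eq_sym eqEcard !card_part // leqnn andbT.
apply/subsetP => v vB; rewrite inE (subsetP sub) //.
by move: vB; rewrite inE => /andP[].
Qed.

(* Merging the blocks of a heavy union would reduce the number of blocks. *)
Lemma minimal_blocks e : exists2 b, valid e b &
  forall B, B != setT -> (forall i j, i \in B -> b j = b i -> j \in B) ->
    (exists i j, [/\ i \in B, j \in B & b i != b j]) -> ~~ heavy e B.
Proof.
pose b0 : {ffun 'I_r -> 'I_r} := [ffun i => i].
have v0 : valid e b0.
  apply/andP; split.
    by rewrite card_imset ?cardsT ?card_ord // => i j; rewrite !ffunE.
  apply/forallP => i; have -> : block b0 i = [set i] by apply/setP => j; rewrite !inE !ffunE.
  by rewrite cards1.
have [b vb bmin] := arg_minnP (fun b => #|b @: setT|) v0.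
exists b => // B BT closed [i0 [i1 [i0B i1B b01]]]; apply/negP => hB.
pose b' : {ffun 'I_r -> 'I_r} := [ffun i => if i \in B then b i0 else b i].
have sub : b' @: setT \subset b @: setT.
  by apply/subsetP => _ /imsetP[i _ ->]; rewrite ffunE; case: ifP => _; exact: imset_f.
have notin : b i1 \notin b' @: setT.
  apply/negP => /imsetP[i _]; rewrite ffunE; case: ifP => iB E1; first by rewrite E1 eqxx in b01.
  by have := closed _ _ i1B (esym E1); rewrite iB.
have smaller : #|b' @: setT| < #|b @: setT|.
  apply: proper_card; apply/properP; split=> //; exists (b i1) => //; exact: imset_f.
have /subsetPn[i2 _ i2B] : ~~ (setT \subset B) by rewrite subTset.
suff vb' : valid e b' by have := bmin _ vb'; rewrite leqNgt smaller.
have b02 : b i0 != b i2 by apply: contraNneq i2B => E1; apply: closed i0B _.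
apply/andP; split.
  have -> : 1 = #|[set b i0]| by rewrite cards1.
  apply: proper_card; apply/properP; split.
    by rewrite sub1set; apply/imsetP; exists i0 => //; rewrite ffunE i0B.
  exists (b i2); last by rewrite inE eq_sym.
  by apply/imsetP; exists i2; rewrite // ffunE (negbTE i2B).
apply/forallP => i; case/andP: vb => _ /forallP/(_ i) vbi.
case iB: (i \in B).
  have -> : block b' i = B.
    apply/setP => j; rewrite inE !ffunE iB; case jB: (j \in B); first by rewrite eqxx.
    by apply/negP => /eqP/(closed _ _ i0B); rewrite jB.
  by rewrite hB implybT.
have -> // : block b' i = block b i.
apply/setP => j; rewrite !inE !ffunE iB; case jB: (j \in B) => //.
have bji : b j != b i by apply/negP => /eqP/esym/(closed _ _ jB); rewrite iB.
rewrite (negbTE bji); apply/negP => /eqP/esym/(closed _ _ i0B); by rewrite iB.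
Qed.

Definition threshold S : nat := s ^ (r - #|S|).

(** Chunks of a heavy set have the critical size up to a factor two. A set of codegree at most the
    threshold keeps one chunk; by the degree bound this covers single vertices. *)
Definition is_chunking (g : {set T} -> {set T} -> {set T}) : Prop :=
  forall S, let X := [set e in E | S \subset e] in
    [/\ forall e, e \in X -> #|[set f in X | g S f == g S e]| <= 2 * threshold S,
        threshold S <= codegree S ->
          forall e, e \in X -> threshold S <= #|[set f in X | g S f == g S e]|
      & codegree S <= threshold S -> {in X &, forall e f, g S e = g S f}].

Lemma exists_chunking : exists g, is_chunking g.
Proof.
have [|g gP] := @fin_all_exists {set T} (fun=> {set T} -> {set T}) (fun S g =>
  let X := [set e in E | S \subset e] in
    [/\ forall e, e \in X -> #|[set f in X | g f == g e]| <= 2 * threshold S,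
        threshold S <= codegree S ->
          forall e, e \in X -> threshold S <= #|[set f in X | g f == g e]|
      & codegree S <= threshold S -> {in X &, forall e f, g e = g f}]).
  move=> S; have th_gt0 : 0 < threshold S by rewrite expn_gt0 s_gt0.
  by have [g [_ g1 g2 g3]] := chunking [set e in E | S \subset e] th_gt0; exists g.
by exists g.
Qed.

Variables (g : {set T} -> {set T} -> {set T}) (b : {ffun 'I_r -> 'I_r}) (E1 : {set {set T}}).
Hypothesis chunk_g : is_chunking g.
Hypothesis E1E : E1 \subset E.
Hypothesis E1_valid : forall e, e \in E1 -> valid e b.
Hypothesis E1_light : forall e B, e \in E1 -> B != setT ->
  (forall i j, i \in B -> b j = b i -> j \in B) ->
  (exists i j, [/\ i \in B, j \in B & b i != b j]) -> ~~ heavy e B.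

(** The contracted vertex of [e] at coordinate [i]. The chunk is part of its identity, so edges
    through one heavy set may have different units there. *)
Definition unit_of (i : 'I_r) e : {set T} * {set T} :=
  (part e (block b i), g (part e (block b i)) e).

Definition common e f : {set 'I_r} := [set i | unit_of i f == unit_of i e].

Lemma block_eq i j : b i = b j -> block b i = block b j.
Proof. by move=> bij; apply/setP => k; rewrite !inE bij. Qed.

Lemma unit_of_block i j : b i = b j -> unit_of i =1 unit_of j.
Proof. by move=> bij e; rewrite /unit_of (block_eq bij). Qed.

Let inE1 e : e \in E1 -> e \in E. Proof. exact: (subsetP E1E). Qed.

Lemma unit_of_part i e f v : unit_of i e = unit_of i f -> v \in e -> b (pi v) = b i -> v \in f.
Proof.
case=> /setP/(_ v) + _ => + ve bv; rewrite !inE ve bv eqxx /= andbT.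
by move=> /esym.
Qed.

Lemma common_sub e f v : v \in e -> pi v \in common e f -> v \in f.
Proof. by move=> ve; rewrite inE => /eqP/esym U; exact: unit_of_part U ve erefl. Qed.

Lemma common_full e f : common e f = setT -> e = f.
Proof.
move=> C; apply/setP => v; apply/idP/idP => vin; first by apply: (common_sub vin); rewrite C inE.
have : pi v \in common e f by rewrite C inE.
by rewrite inE => /eqP U; exact: unit_of_part U vin erefl.
Qed.

Lemma common_closed e f i j : i \in common e f -> b j = b i -> j \in common e f.
Proof. by rewrite !inE => + bji; rewrite !(unit_of_block bji). Qed.

(** A union of several blocks is light, so few edges contain the part of [e] in it. For a single
    block the edges counted lie in the chunk of [e], whence the factor [2]. *)
Lemma card_common e B : e \in E1 -> B != set0 -> B != setT ->
  #|[set f in E1 | common e f == B]| <= 2 * s ^ (r - #|B|).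
Proof.
move=> eE1 /set0Pn[i0 i0B] BT.
have [->|[f0]] := set_0Vmem [set f in E1 | common e f == B]; first by rewrite cards0.
rewrite inE => /andP[_ /eqP f0B].
have closed i j : i \in B -> b j = b i -> j \in B by rewrite -f0B; exact: common_closed.
have [/existsP[i /existsP[j /and3P[iB jB bij]]]|/existsPn single] :=
    boolP [exists i, exists j, [&& i \in B, j \in B & b i != b j]].
  have : ~~ heavy e B by apply: (E1_light eE1 BT closed); exists i, j.
  rewrite -ltnNge => /ltnW light.
  apply: (@leq_trans (s ^ (r - #|B|))); last by rewrite leq_pmull.
  apply: leq_trans light.
  apply: subset_leq_card; apply/subsetP => f; rewrite !inE => /andP[fE1 /eqP fB].
  rewrite inE1 //=; apply/subsetP => v; rewrite inE => /andP[ve vB].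
  by apply: (common_sub ve); rewrite fB.
have BE : B = block b i0.
  apply/setP => j; rewrite inE; apply/idP/eqP => [jB|]; last exact: closed.
  by have /existsPn/(_ i0) := single j; rewrite jB i0B /= negbK => /eqP.
have [le_g _ _] := chunk_g (part e B).
rewrite -(card_part B (inE1 eE1)); apply: leq_trans (le_g e _); last first.
  by rewrite inE inE1 // part_sub.
apply: subset_leq_card; apply/subsetP => f; rewrite inE => /andP[fE1 /eqP fB].
have : i0 \in common e f by rewrite fB.
rewrite inE /unit_of -BE => /eqP[pE gE]; rewrite !inE inE1 //= -{1}pE part_sub /=.
by rewrite -{1}pE gE.
Qed.

(** * Counting the clashes of an edge *)

Definition clashing_edges e : {set {set T}} :=
  [set f in E1 | (f != e) && (common e f != set0)].

(** Singleton blocks are left out because there all edges through a vertex have the same unit. *)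
Definition clashing_units e : {set ({set T} * {set T}) * 'I_r} :=
  [set u | [&& 1 < #|block b u.2|, u.1 != unit_of u.2 e
    & [exists f in E1, (u.1 == unit_of u.2 f) && (u.1.1 :&: e != set0)]]].

Lemma clashing_units_new e u j : u \in clashing_units e -> j \in block b u.2 ->
  unit_of j e != u.1.
Proof.
rewrite !inE => /and3P[_ ne _] /eqP bj; rewrite (unit_of_block bj).
by rewrite eq_sym.
Qed.

(** At a block of several parts, a different unit through [v] would clash. At a singleton block the
    degree bound puts all edges through [v] into one chunk. *)
Lemma meeting_same_unit e f v : e \in E1 -> f \in E1 -> v \in e -> v \in f ->
  (unit_of (pi v) f, pi v) \notin clashing_units e -> unit_of (pi v) f = unit_of (pi v) e.
Proof.
move=> eE1 fE1 ve vf; rewrite inE /= => H; apply/eqP; apply: contraNT H => ne.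
have vS : v \in part f (block b (pi v)) by rewrite inE vf block_refl.
rewrite ne /=; apply/andP; split; last first.
  apply/exists_inP; exists f => //; rewrite eqxx /=; apply/set0Pn; exists v.
  by rewrite inE ve vS.
apply: contraNT ne; rewrite -leqNgt => small.
have B1 : block b (pi v) = [set pi v].
  by apply/esym/eqP; rewrite eqEcard sub1set block_refl cards1.
have partv h : h \in E1 -> v \in h -> part h (block b (pi v)) = [set v].
  move=> hE1 vh; rewrite B1; apply/setP => u; rewrite !inE; apply/andP/eqP => [[uh /eqP]|->//].
  by move/(pi_inj (inE1 hE1) uh vh).
rewrite /unit_of !partv //; apply/eqP; congr (_, _).
have [_ _ const] := chunk_g [set v].
apply: const; rewrite ?inE ?inE1 ?sub1set //.
rewrite /threshold cards1; apply: leq_trans (degE v); apply: subset_leq_card.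
by apply/subsetP => h; rewrite !inE sub1set.
Qed.

(** A block of size [m > 1] is heavy, so each unit through [v] owns at least [s ^ (r - m)] of the at
    most [s ^ (r - 1)] edges at [v], and different units own disjoint sets of edges. *)
Lemma card_units_at (i : 'I_r) v :
  #|[set w | [exists f in E1, (w == unit_of i f) && (v \in w.1)]]| <= s ^ (#|block b i| - 1)
  \/ #|block b i| <= 1.
Proof.
have [|m_gt1] := leqP #|block b i| 1; [by right | left].
set N := [set w | _]; set m := #|block b i| in m_gt1 *.
have m_le : m <= r by rewrite -[leqRHS]card_ord max_card.
have : #|N| * s ^ (r - m) <= s ^ (r - 1).
  apply: leq_trans (degE v).
  rewrite -sum_nat_const -[leqRHS]sum1_card.
  apply: (@leq_trans (\sum_(w in N) \sum_(f in [set e in E | v \in e] | unit_of i f == w) 1)).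
    apply: leq_sum => w; rewrite inE => /exists_inP[f0 f0E1 /andP[/eqP wE vw]].
    have [_ ge_g _] := chunk_g w.1.
    have w1E : w.1 = part f0 (block b i) by rewrite wE.
    have cw : #|w.1| = m by rewrite w1E card_part // inE1.
    have hv : threshold w.1 <= codegree w.1.
      have /andP[_ /forallP/(_ i)/implyP/(_ m_gt1)] := E1_valid f0E1.
      by rewrite /heavy /threshold cw w1E.
    have f0X : f0 \in [set e in E | w.1 \subset e] by rewrite inE inE1 // w1E part_sub.
    rewrite -/m -cw; apply: leq_trans (ge_g hv f0 f0X) _.
    rewrite sum1dep_card; apply: subset_leq_card; apply/subsetP => f.
    rewrite !inE => /andP[/andP[fE wf] gf]; rewrite fE (subsetP wf _ vw) /=.
    have pE : part f (block b i) = part f0 (block b i).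
      by apply: part_eq => //; [exact: inE1 | rewrite -w1E].
    rewrite /unit_of pE -w1E {3}wE /unit_of -w1E xpair_eqE eqxx /=.
    by move: gf => /eqP ->.
  rewrite (exchange_big_dep (mem [set e in E | v \in e])) /=; last by move=> w f _ /andP[].
  apply: leq_sum => f _; rewrite sum1dep_card.
  apply: leq_trans (_ : #|[set unit_of i f]| <= 1); last by rewrite cards1.
  apply: subset_leq_card; apply/subsetP => w; rewrite !inE => /andP[_ /andP[_ /eqP->]].
  by [].
have -> : r - 1 = (m - 1) + (r - m) by lia.
by rewrite expnD leq_pmul2r // expn_gt0 s_gt0.
Qed.

Variable q : nat.
Hypothesis q_big : 2 * (2 ^ r * 2 + r * r) * s <= q.

Let s_le_q : s <= q.
Proof. nia. Qed.

(** Each of the [2 ^ r] possible common sets [B] contributes at most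
    [2 * s ^ (r - #|B|) * q ^ #|B|]. As [#|B| < r] and [s <= q], all but one factor [s] may be
    replaced by [q]. *)
Lemma sum_clashing_edges e : e \in E1 ->
  \sum_(f in clashing_edges e) q ^ (r - #|differ unit_of e f|) <= 2 ^ r * 2 * (s * q ^ (r - 1)).
Proof.
move=> eE1.
have differE f : r - #|differ unit_of e f| = #|common e f|.
  have -> : differ unit_of e f = ~: common e f by apply/setP => i; rewrite !inE.
  have := cardsC (common e f); rewrite card_ord; lia.
rewrite (eq_bigr _ (fun f _ => congr1 (expn q) (differE f))).
rewrite (partition_big (common e) xpredT) //=.
have -> : 2 ^ r * 2 * (s * q ^ (r - 1)) = \sum_(B : {set 'I_r}) 2 * (s * q ^ (r - 1)).
  rewrite sum_nat_const; have -> : #|{: {set 'I_r}}| = 2 ^ r; last by rewrite -mulnA.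
  by rewrite -cardsT -powersetT card_powerset cardsT card_ord.
apply: leq_sum => B _.
have [B0|[f]] := set_0Vmem [set f in clashing_edges e | common e f == B].
  rewrite big_pred0 // => f; apply/negP => H.
  have : f \in [set f in clashing_edges e | common e f == B] by rewrite inE.
  by rewrite B0 inE.
rewrite !inE -!andbA => /and4P[_ fe Bn0 /eqP fB].
have BT : B != setT.
  by apply: contraNneq fe => BT; apply/eqP/esym; apply: common_full; rewrite fB.
rewrite fB in Bn0.
apply: (@leq_trans (\sum_(f in E1 | common e f == B) q ^ #|B|)).
  rewrite big_mkcond [leqRHS]big_mkcond; apply: leq_sum => h _; rewrite !inE.
  case: (h \in E1) => //=; case: (common e h =P B) => [->|]; rewrite ?andbF //.
  by case: ifP.
rewrite sum_nat_const.
have -> : #|[pred f | (f \in E1) & common e f == B]| = #|[set f in E1 | common e f == B]|.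
  by apply: eq_card => h; rewrite !inE.
apply: leq_trans (leq_mul (card_common eE1 Bn0 BT) (leqnn _)) _.
have B_lt : #|B| < r.
  by rewrite -[ltnRHS]card_ord -cardsT; apply: proper_card; rewrite properT.
rewrite -mulnA leq_pmul2l //.
have -> : r - #|B| = (r - #|B| - 1).+1 by lia.
have -> : r - 1 = (r - #|B| - 1) + #|B| by lia.
by rewrite expnS expnD -!mulnA leq_mul2l leq_mul2r leq_expn_base ?orbT.
Qed.

(** For each coordinate and each vertex of [e] there are at most [s ^ (m - 1)] units of weight
    [q ^ (r + 1 - m)], where [m >= 2] is the block size. Again all but one factor [s] may become
    [q]. *)
Lemma sum_clashing_units e : e \in E1 ->
  \sum_(u in clashing_units e) q ^ (r + 1 - #|block b u.2|) <= r * r * (s * q ^ (r - 1)).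
Proof.
move=> eE1.
rewrite (partition_big snd xpredT) //=.
have -> : r * r * (s * q ^ (r - 1)) = \sum_(i < r) r * (s * q ^ (r - 1)).
  by rewrite sum_nat_const card_ord -mulnA.
apply: leq_sum => i _.
have [small|m_gt1] := leqP #|block b i| 1.
  rewrite big_pred0 // => u; apply/negP => /andP[]; rewrite inE => /andP[+ _] /eqP ui.
  by rewrite ui ltnNge small.
have m_le : #|block b i| <= r by rewrite -[leqRHS]card_ord max_card.
set m := #|block b i| in m_gt1 m_le.
pose N v := [set w | [exists f in E1, (w == unit_of i f) && (v \in w.1)]].
pose A := [set u in clashing_units e | u.2 == i].
have cA : #|A| <= r * s ^ (m - 1).
  have <- : #|[set u.1 | u in A]| = #|A|.
    apply: card_in_imset => -[w1 j1] [w2 j2]; rewrite !inE /=.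
    by move=> /andP[_ /eqP->] /andP[_ /eqP->] ->.
  apply: leq_trans (leq_card_bigcup (e := e) (N := N) _) _.
    apply/subsetP => _ /imsetP[u + ->]; rewrite !inE => /andP[/and3P[_ _ H] /eqP ui].
    case/exists_inP: H => f fE1 /andP[uE /set0Pn[v]]; rewrite inE => /andP[vu ve].
    by apply/bigcupP; exists v; rewrite // inE; apply/exists_inP; exists f; rewrite // -ui uE.
  rewrite -(card_edge (inE1 eE1)) -sum_nat_const; apply: leq_sum => v _.
  by have [//|] := card_units_at i v; rewrite leqNgt m_gt1.
apply: (@leq_trans (#|A| * q ^ (r + 1 - m))).
  rewrite -sum_nat_const leq_eqVlt; apply/orP; left; apply/eqP.
  rewrite [RHS](eq_bigl (fun u => (u \in clashing_units e) && (u.2 == i))); last first.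
    by move=> u; rewrite inE.
  by apply: eq_bigr => u /andP[_ /eqP->].
apply: leq_trans (leq_mul cA (leqnn _)) _.
rewrite -mulnA leq_mul2l; apply/orP; right.
have -> : m - 1 = (m - 2).+1 by lia.
have -> : r - 1 = (m - 2) + (r + 1 - m) by lia.
by rewrite expnS expnD -!mulnA leq_mul2l leq_mul2r leq_expn_base ?orbT.
Qed.

(** The constant in [q_big] is twice the sum of the two clash constants, as the smallness condition
    of [alteration] demands. *)
Lemma few_clashes e : e \in E1 ->
  2 * (\sum_(f in clashing_edges e) q ^ (r - #|differ unit_of e f|)
     + \sum_(u in clashing_units e) q ^ (r + 1 - #|block b u.2|)) <= q ^ r.
Proof.
move=> eE1.
have := leq_add (sum_clashing_edges eE1) (sum_clashing_units eE1).
have -> : q ^ r = q * q ^ (r - 1) by rewrite -expnS; congr (_ ^ _); lia.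
have := leq_mul q_big (leqnn (q ^ (r - 1))).
lia.
Qed.

End Units.

(** * Berge cycles and labellings *)

(* A set [J] of tuples is an r-partite r-graph with parts [{i} * X]. *)
Section Tuples.
Variables (r : nat) (X : finType) (J : {set {ffun 'I_r -> X}}).

Definition linear_tuples : Prop :=
  forall E1 E2 (i j : 'I_r), E1 \in J -> E2 \in J -> i != j ->
    E1 i = E2 i -> E1 j = E2 j -> E1 = E2.

Definition triangle_free_tuples : Prop :=
  forall E1 E2 E3 (i j k : 'I_r), E1 \in J -> E2 \in J -> E3 \in J ->
    [&& i != j, j != k & k != i] ->
    E1 i = E2 i -> E2 j = E3 j -> E3 k = E1 k -> E1 = E2.

Definition quad_free_tuples : Prop :=
  forall E1 E2 E3 E4 (i j k l : 'I_r),
    E1 \in J -> E2 \in J -> E3 \in J -> E4 \in J ->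
    [&& i != j, j != k, k != l & l != i] ->
    E1 i = E2 i -> E2 j = E3 j -> E3 k = E4 k -> E4 l = E1 l ->
    E1 = E2 \/ E4 = E1.

End Tuples.

Section TupleCycles.
Variables (r : nat) (X : finType) (J : {set {ffun 'I_r -> X}}).
Hypotheses (linJ : linear_tuples J) (triJ : triangle_free_tuples J).
Implicit Types E : {ffun 'I_r -> X}.

(** If two consecutive coordinates agree, the tuple between them can be skipped and linearity
    applied to the other two; otherwise the walk is a genuine triangle. *)
Lemma closed_walk3 E0 E1 E2 (j0 j1 j2 : 'I_r) :
    E0 \in J -> E1 \in J -> E2 \in J -> E0 != E1 -> E1 != E2 -> E2 != E0 ->
    E0 j1 = E1 j1 -> E1 j2 = E2 j2 -> E2 j0 = E0 j0 ->
  j0 = j1 /\ j1 = j2.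
Proof.
move=> J0 J1 J2 n01 n12 n20 e1 e2 e0.
have [j01|j01] := eqVneq j0 j1.
  split=> //; apply/eqP; apply: contraNT n12 => j12; apply/eqP.
  by apply: (linJ J1 J2 j12) => //; rewrite -e1 -j01 -e0.
have [j12|j12] := eqVneq j1 j2.
  case/eqP: n20; apply: (linJ J2 J0 j01) => //.
  by rewrite e1 j12 e2.
have [j20|j20] := eqVneq j2 j0.
  by case/eqP: n01; apply: (linJ J0 J1 j01) => //; rewrite -e0 -j20 -e2 .
by case/eqP: n01; apply: (triJ J0 J1 J2 _ e1 e2 e0); rewrite j12 j20 j01.
Qed.

(** Skipping the tuple between two equal consecutive coordinates leaves a closed walk of length
    three; without such a pair [quadJ] applies. *)
Lemma closed_walk4 E0 E1 E2 E3 (j0 j1 j2 j3 : 'I_r) :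
    quad_free_tuples J -> E0 \in J -> E1 \in J -> E2 \in J -> E3 \in J ->
    uniq [:: E0; E1; E2; E3] ->
    E0 j1 = E1 j1 -> E1 j2 = E2 j2 -> E2 j3 = E3 j3 -> E3 j0 = E0 j0 ->
  [/\ j0 = j1, j1 = j2 & j2 = j3].
Proof.
move=> quadJ J0 J1 J2 J3; rewrite /= !inE !negb_or -!andbA.
move=> /and4P[n01 n02 n03 /and4P[n12 n13 n23 _]] e1 e2 e3 e0.
have [n20 n30 n31] : [/\ E2 != E0, E3 != E0 & E3 != E1].
  by split; rewrite eq_sym.
have [j01|j01] := eqVneq j0 j1.
  have e' : E3 j1 = E1 j1 by rewrite -e1 -j01.
  by have [<- <-] := closed_walk3 J1 J2 J3 n12 n23 n31 e2 e3 e'.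
have [j12|j12] := eqVneq j1 j2.
  have e' : E0 j2 = E2 j2 by rewrite -e2 -j12.
  by have [<- E] := closed_walk3 J2 J3 J0 n23 n30 n02 e3 e0 e'; case/eqP: j01; rewrite -E j12.
have [j23|j23] := eqVneq j2 j3.
  have e' : E1 j3 = E3 j3 by rewrite -e3 -j23.
  have [E E'] := closed_walk3 J3 J0 J1 n30 n01 n13 e0 e1 e'.
  by case/eqP: j12; rewrite j23 E E'.
have [j30|j30] := eqVneq j3 j0.
  have e' : E2 j0 = E0 j0 by rewrite -e0 -j30.
  by have [E _] := closed_walk3 J0 J1 J2 n01 n12 n20 e1 e2 e'; case/eqP: j01.
have [|E|E] := quadJ E0 E1 E2 E3 j1 j2 j3 j0 J0 J1 J2 J3 _ e1 e2 e3 e0.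
- by rewrite j12 j23 j30 j01.
- by rewrite E eqxx in n01.
by rewrite E eqxx in n03.
Qed.

End TupleCycles.

(** * Berge cycles in labelled hypergraphs *)

Section Labelling.
Variables (r : nat) (X T : finType) (J : {set {ffun 'I_r -> X}}) (G : {set {set T}}).

(* [lab] maps the edges of [G] to edges of the r-partite r-graph [J], locally
   injectively; a vertex [v] is sent to the part [col v], and the vertices of an edge
   that are sent to the same part belong to the same edges. *)
Definition labelling (col : T -> 'I_r) (lab : {set T} -> {ffun 'I_r -> X}) : Prop :=
  [/\ forall e, e \in G -> lab e \in J,
      forall e f v, e \in G -> f \in G -> v \in e -> v \in f ->
        lab e (col v) = lab f (col v),
      forall e f v, e \in G -> f \in G -> v \in e -> v \in f -> e != f -> lab e != lab f,
      forall e f u v, e \in G -> f \in G -> u \in e -> u \in f ->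
        v \in e -> col v = col u -> v \in f
    & forall e i, e \in G -> #|[set v in e | col v == i]| < r].

Variables (col : T -> 'I_r) (lab : {set T} -> {ffun 'I_r -> X}).
Hypothesis labG : labelling col lab.
Hypotheses (linJ : linear_tuples J) (triJ : triangle_free_tuples J).

(** [closed_walk3] sends the three vertices to one part, so all of them lie in the first edge. Then
    at least [r] vertices of that edge share a part, which a labelling forbids. *)
Lemma labelling_no_berge3 (e : 'I_3 -> {set T}) (v : 'I_3 -> T) :
  r <= 3 -> (forall i, e i \in G) -> injective e -> injective v ->
  (forall i, v i \in e i /\ v (ordS i) \in e i) -> False.
Proof.
move=> r3 eG e_inj v_inj inc; have [labJ labE labN same few] := labG.
pose i0 : 'I_3 := ord0; pose i1 := ordS i0; pose i2 := ordS i1.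
have S2 : ordS i2 = i0 by apply: val_inj.
have [v00 v10] := inc i0; have [v11 v21] := inc i1; have [v22] := inc i2; rewrite S2 => v02.
have n01 : e i0 != e i1 by rewrite (inj_eq e_inj).
have n12 : e i1 != e i2 by rewrite (inj_eq e_inj).
have n20 : e i2 != e i0 by rewrite (inj_eq e_inj).
have [c01 c12] : col (v i0) = col (v i1) /\ col (v i1) = col (v i2).
  apply: (closed_walk3 linJ triJ (labJ _ (eG i0)) (labJ _ (eG i1)) (labJ _ (eG i2))).
  - exact: labN (eG i0) (eG i1) v10 v11 n01.
  - exact: labN (eG i1) (eG i2) v21 v22 n12.
  - exact: labN (eG i2) (eG i0) v02 v00 n20.
  - exact: labE (eG i0) (eG i1) v10 v11.
  - exact: labE (eG i1) (eG i2) v21 v22.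
  - exact: labE (eG i2) (eG i0) v02 v00.
have v20 : v i2 \in e i0 := same _ _ _ _ (eG i1) (eG i0) v11 v10 v21 (esym c12).
have := few _ (col (v i0)) (eG i0); rewrite ltnNge => /negP; apply.
apply: leq_trans r3 _; rewrite -[leqLHS](card_ord 3) -(card_imset _ v_inj).
apply: subset_leq_card; apply/subsetP => _ /imsetP[i _ ->]; rewrite inE.
case: i => -[|[|[|//]]] lti.
- by rewrite (_ : Ordinal lti = i0) ?v00 ?eqxx //; apply: val_inj.
- by rewrite (_ : Ordinal lti = i1) ?v10 ?c01 ?eqxx //; apply: val_inj.
- by rewrite (_ : Ordinal lti = i2) ?v20 ?c01 ?c12 ?eqxx //; apply: val_inj.
Qed.

(** Opposite edges may be disjoint, so local injectivity need not apply to them directly. If [v1]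
    and [v2] share a part, then [v2] lies in [e0] and it does apply; otherwise equal labels of [e0]
    and [e2] would make those of [e0] and [e1] agree at two coordinates. *)
Lemma labelling_opposite e0 e1 e2 v1 v2 :
  e0 \in G -> e1 \in G -> e2 \in G -> e0 != e1 -> e1 != e2 -> e2 != e0 ->
  v1 \in e0 -> v1 \in e1 -> v2 \in e1 -> v2 \in e2 -> lab e0 != lab e2.
Proof.
move=> G0 G1 G2 n01 n12 n20 v10 v11 v21 v22; have [labJ labE labN same _] := labG.
have [c12|c12] := eqVneq (col v1) (col v2).
  have v20 := same _ _ _ _ G1 G0 v11 v10 v21 (esym c12).
  by apply: (labN _ _ _ G0 G2 v20 v22); rewrite eq_sym.
apply/eqP => E; have /eqP[] := labN _ _ _ G0 G1 v10 v11 n01.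
apply: (linJ (labJ _ G0) (labJ _ G1) c12); first exact: labE.
by rewrite E; symmetry; apply: labE.
Qed.

Lemma labelling_no_berge4 (e : 'I_4 -> {set T}) (v : 'I_4 -> T) :
  quad_free_tuples J ->
  r <= 4 -> (forall i, e i \in G) -> injective e -> injective v ->
  (forall i, v i \in e i /\ v (ordS i) \in e i) -> False.
Proof.
move=> quadJ r4 eG e_inj v_inj inc; have [labJ labE labN same few] := labG.
pose i0 : 'I_4 := ord0; pose i1 := ordS i0; pose i2 := ordS i1; pose i3 := ordS i2.
have S3 : ordS i3 = i0 by apply: val_inj.
have [v00 v10] := inc i0; have [v11 v21] := inc i1; have [v22 v32] := inc i2.
have [v33] := inc i3; rewrite S3 => v03.
have n i j : i != j -> e i != e j by rewrite (inj_eq e_inj).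
have [c01 c12 c23] : [/\ col (v i0) = col (v i1), col (v i1) = col (v i2)
    & col (v i2) = col (v i3)].
  apply: (closed_walk4 linJ triJ quadJ (labJ _ (eG i0)) (labJ _ (eG i1))
    (labJ _ (eG i2)) (labJ _ (eG i3))).
  - rewrite /= !inE !negb_or -!andbA !andbT.
    rewrite (labN _ _ _ (eG i0) (eG i1) v10 v11) ?n //.
    rewrite (labelling_opposite (eG i0) (eG i1) (eG i2) _ _ _ v10 v11 v21 v22) ?n //=.
    rewrite (labN _ _ _ (eG i0) (eG i3) v00 v03) ?n //.
    rewrite (labN _ _ _ (eG i1) (eG i2) v21 v22) ?n //.
    rewrite (labelling_opposite (eG i1) (eG i2) (eG i3) _ _ _ v21 v22 v32 v33) ?n //=.
    by rewrite (labN _ _ _ (eG i2) (eG i3) v32 v33) ?n.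
  - exact: labE (eG i0) (eG i1) v10 v11.
  - exact: labE (eG i1) (eG i2) v21 v22.
  - exact: labE (eG i2) (eG i3) v32 v33.
  - exact: labE (eG i3) (eG i0) v03 v00.
have v20 : v i2 \in e i0 := same _ _ _ _ (eG i1) (eG i0) v11 v10 v21 (esym c12).
have v30 : v i3 \in e i0 := same _ _ _ _ (eG i2) (eG i0) v22 v20 v32 (esym c23).
have := few _ (col (v i0)) (eG i0); rewrite ltnNge => /negP; apply.
apply: leq_trans r4 _; rewrite -[leqLHS](card_ord 4) -(card_imset _ v_inj).
apply: subset_leq_card; apply/subsetP => _ /imsetP[i _ ->]; rewrite inE.
case: i => -[|[|[|[|//]]]] lti.
- by rewrite (_ : Ordinal lti = i0) ?v00 ?eqxx //; apply: val_inj.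
- by rewrite (_ : Ordinal lti = i1) ?v10 ?c01 ?eqxx //; apply: val_inj.
- by rewrite (_ : Ordinal lti = i2) ?v20 ?c01 ?c12 ?eqxx //; apply: val_inj.
- by rewrite (_ : Ordinal lti = i3) ?v30 ?c01 ?c12 ?c23 ?eqxx //; apply: val_inj.
Qed.

End Labelling.

(** * Extracting a labelled subgraph *)

Lemma ex_number_lower_bound l r (T : finType) (H : unigraph r T) (G : {set {set T}}) :
    G \subset edges H ->
    (forall (e : 'I_l -> {set T}) (v : 'I_l -> T), (forall i, e i \in G) ->
      injective e -> injective v -> (forall i, v i \in e i /\ v (ordS i) \in e i) -> False) ->
  #|G| <= ex_number H (berge_cycle l r).
Proof.
move=> GH noG.
have GP : is_unigraph r (vertices H, G).
  apply/forall_inP => e /(subsetP GH) eH.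
  by have /forall_inP/(_ e eH) := unigraph_valP H.
pose K := UniGraph GP.
apply: (@leq_bigmax_cond _ _ (fun G : unigraph r T => #|edges G|) K).
rewrite /subgraph subxx GH /=; apply/asboolP => T' A K' [e [v [e_inj eA v_inj inc]]] /andP[_ sub].
case=> h [h_inj hV hE].
have edgeV (f : {set T}) : f \in edges K' -> f \subset vertices K'.
  by move=> fK; have /forall_inP/(_ f fK)/andP[] := unigraph_valP K'.
have /fin_all_exists[e' e'P] i : exists f, f \in edges K' /\ e i = h @: f.
  have : e i \in edges A by rewrite eA imset_f.
  by rewrite -hE => /imsetP[f fK ->]; exists f.
have /fin_all_exists[v' v'P] i : exists u, u \in e' i /\ v i = h u.
  have [vi _] := inc i; have [_ eE] := e'P i.
  by move: vi; rewrite eE => /imsetP[u ue ->]; exists u.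
apply: (noG e' v').
- by move=> i; apply: (subsetP sub); have [] := e'P i.
- by move=> i j E; apply: e_inj; have [_ ->] := e'P i; have [_ ->] := e'P j; rewrite E.
- by move=> i j E; apply: v_inj; have [_ ->] := v'P i; have [_ ->] := v'P j; rewrite E.
move=> i; split; first by have [] := v'P i.
have [_] := inc i; have [eK ->] := e'P i; have [ve ->] := v'P (ordS i).
(* [h] is injective only on the vertices of [K']; both points belong to edges of [K'] and hence lie
   there. *)
case/imsetP => u ue /h_inj E; rewrite E //.
- by apply: (subsetP (edgeV _ _) _ ve); have [] := e'P (ordS i).
- exact: (subsetP (edgeV _ eK)).
Qed.

(** One fixed bijective colouring of an edge already has probability [1 / r ^ r]. *)
Lemma rainbow_colouring (r : nat) (T : finType) (E : {set {set T}}) :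
  0 < r -> (forall e, e \in E -> #|e| = r) ->
  exists pi : {ffun T -> 'I_r}, #|E| <= r ^ r * #|[set e in E | dinjectiveb pi e]|.
Proof.
move=> r_gt0 uniE.
have [||pi] := @averaging {ffun T -> 'I_r} {set T} E
  (fun pi e => dinjectiveb pi e) 1 (r ^ r); last first.
- by rewrite mul1n; exists pi.
- move=> e eE; pose z (i : 'I_r) : T := enum_val (cast_ord (esym (uniE e eE)) i).
  have z_inj : injective z by move=> i j /enum_val_inj/cast_ord_inj.
  have := card_ffun_restrict [set [ffun i : 'I_r => i]] z_inj.
  rewrite cards1 !mul1n card_ord card_ffun card_ord => <-; rewrite mulnC leq_mul2l.
  apply/orP; right; apply: subset_leq_card; apply/subsetP => pi; rewrite !inE => /eqP/ffunP H.
  apply/dinjectiveP => u v ue ve.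
  have zE w (we : w \in e) : w = z (cast_ord (uniE e eE) (enum_rank_in we w)).
    by rewrite /z cast_ordK enum_rankK_in.
  rewrite (zE u ue) (zE v ve).
  have := H (cast_ord (uniE e eE) (enum_rank_in ue u)).
  have := H (cast_ord (uniE e eE) (enum_rank_in ve v)).
  by rewrite !ffunE => -> -> ->.
- by rewrite card_ffun card_ord expn_gt0 r_gt0.
Qed.

(** Passing to rainbow edges, and then to edges with a common partition, costs [r ^ r] each time;
    [alteration] costs a factor [2] besides the density of [J]. *)
Lemma exists_labelling (r s : nat) (X T : finType) (J : {set {ffun 'I_r -> X}}) (H : unigraph r T) :
    1 < r -> 0 < s -> linear_tuples J -> max_degree H <= s ^ (r - 1) ->
    2 * (2 ^ r * 2 + r * r) * s <= #|X| ->
  exists (G : {set {set T}}) col lab,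
    [/\ G \subset edges H, labelling J G col lab
      & #|J| * #|edges H| <= 2 * r ^ r * r ^ r * #|X| ^ r * #|G|].
Proof.
move=> r_gt1 s_gt0 linJ degH q_big.
have r_gt0 : 0 < r by exact: ltnW.
have edgeP e : e \in edges H -> #|e| = r /\ e \subset vertices H.
  by move=> eH; have /forall_inP/(_ e eH)/andP[/eqP] := unigraph_valP H.
have [pi bigE] := rainbow_colouring r_gt0 (fun e eH => (edgeP e eH).1).
set E := [set e in _ | _] in bigE.
have EH : E \subset edges H by apply/subsetP => e; rewrite inE => /andP[].
have pi_inj e : e \in E -> {in e &, injective pi}.
  by rewrite inE => /andP[_ /dinjectiveP].
have pi_onto e : e \in E -> pi @: e = setT.
  move=> eE; apply/eqP; rewrite eqEcard subsetT cardsT card_ord card_in_imset.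
    by have [-> _] := edgeP e (subsetP EH _ eE); rewrite leqnn.
  exact: pi_inj.
have degE v : #|[set e in E | v \in e]| <= s ^ (r - 1).
  apply: leq_trans degH; have [vH|vH] := boolP (v \in vertices H).
    apply: (leq_trans _ (@leq_bigmax_cond _ (mem (vertices H)) (degree H) v vH)).
    apply: subset_leq_card; apply/subsetP => e.
    by rewrite !inE => /andP[/andP[-> _] ->].
  rewrite (_ : [set e in E | v \in e] = set0) ?cards0 //; apply/setP => e; rewrite !inE.
  apply/negP => /andP[/andP[eH _] ve]; case/negP: vH.
  exact: (subsetP (edgeP e eH).2).
have [bf bfv bfl] := fin_all_exists2 (minimal_blocks s pi E r_gt1).
have [||b bigE1] := @averaging {ffun 'I_r -> 'I_r} {set T} E (fun b e => bf e == b) 1 (r ^ r).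
- by rewrite card_ffun card_ord expn_gt0 r_gt0.
- move=> e _; rewrite mul1n card_ffun card_ord.
  rewrite (_ : [set w | bf e == w] = [set bf e]) ?cards1 ?muln1 //.
  by apply/setP => w; rewrite !inE eq_sym.
set E1 := [set e in _ | _] in bigE1.
have E1E : E1 \subset E by apply/subsetP => e; rewrite inE => /andP[].
have E1v e : e \in E1 -> valid s pi E e b by rewrite inE => /andP[_ /eqP <-].
have E1l e B : e \in E1 -> B != setT -> (forall i j, i \in B -> b j = b i -> j \in B) ->
    (exists i j, [/\ i \in B, j \in B & b i != b j]) -> ~~ heavy s pi E e B.
  by rewrite inE => /andP[_ /eqP <-]; exact: bfl.
have [g gP] := exists_chunking r E s_gt0.
pose U := unit_of pi g b.
have X_gt0 : 0 < #|X| by nia.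
(* If no edge is left, [H] has no edges and the empty subgraph will do. *)
have [E10|[e0 e0E1]] := set_0Vmem E1.
  have /card_gt0P[x _] := X_gt0.
  exists set0, (fun=> Ordinal r_gt0), (fun=> [ffun=> x]); split.
  - exact: sub0set.
  - by split=> e; rewrite inE.
  by move: bigE bigE1; rewrite E10 cards0; nia.
have /andP[b_gt1 _] := E1v _ e0E1.
have [i0 [i1 b01]] : exists i0 i1, b i0 != b i1.
  move: b_gt1; rewrite (cardsD1 (b (Ordinal r_gt0))) imset_f //= add1n ltnS card_gt0.
  case/set0Pn => y /setD1P[yn /imsetP[i1 _ yE]].
  by exists i1, (Ordinal r_gt0); rewrite -yE.
(* Copying one entry of [F] over each block lets [alteration] use all [r] coordinates; an edge with
   such a tuple has its units selected. Linearity makes the copying injective, as [b] is not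
   constant. *)
pose comp (F : {ffun 'I_r -> X}) : {ffun 'I_r -> X} := [ffun i => F (b i)].
have comp_inj : {in J &, injective comp}.
  move=> F F' FJ F'J /ffunP EF; apply: (linJ _ _ _ _ FJ F'J b01).
    by have := EF i0; rewrite !ffunE.
  by have := EF i1; rewrite !ffunE.
have [||chi] := @alteration r {set T} _ X U (comp @: J) E1 (clashing_edges pi g b E1)
    (clashing_units pi g b E1) (block b) (block_refl b) _ X_gt0.
- by move=> e u j _; exact: clashing_units_new.
- move=> e eE1; exact: (few_clashes r_gt1 s_gt0 pi_onto pi_inj degE gP E1E E1v E1l q_big eE1).
rewrite card_in_imset // => bigG.
set G := [set e in E1 | _] in bigG.
have GE1 : G \subset E1 by apply/subsetP => e; rewrite inE => /andP[].
have labG e : e \in G -> exists2 F, F \in J & edge_image U chi e = comp F.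
  by rewrite inE => /andP[_ /and3P[/imsetP[F FJ ->] _ _]]; exists F.
(* On [G] the default is never taken, by [labG]. *)
pose lab e := if [pick F in J | edge_image U chi e == comp F] is Some F then F
  else [ffun=> chi (i0, U i0 e)].
have labP e : e \in G -> lab e \in J /\ edge_image U chi e = comp (lab e).
  move=> eG; rewrite /lab; case: pickP => [F /andP[FJ /eqP->] //|N].
  by have [F FJ FE] := labG e eG; have := N F; rewrite FJ FE eqxx.
have chiE e i : e \in G -> chi (i, U i e) = lab e (b i).
  by move=> /labP[_ /ffunP/(_ i)]; rewrite !ffunE.
have sameU e f v : e \in G -> f \in G -> v \in e -> v \in f -> U (pi v) f = U (pi v) e.
  move=> eG fG ve vf.
  have eE1 := subsetP GE1 _ eG; have fE1 := subsetP GE1 _ fG.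
  apply: (meeting_same_unit pi_inj degE gP E1E eE1 fE1 ve vf).
  (* [f] is alive too, so its unit has constant labels on its block; a clash would have deleted
     [e]. *)
  apply/negP => clash; move: eG; rewrite inE => /andP[_ /and3P[_ _ /forall_inP/(_ _ clash)/negP]].
  apply; apply/forall_inP => i /= ib; apply/forall_inP => j jb.
  move: ib jb; rewrite !inE => /eqP ib /eqP jb.
  have := chiE f i fG; have := chiE f j fG.
  by rewrite /U (unit_of_block _ _ ib) (unit_of_block _ _ jb) ib jb => -> ->.
exists G, (fun v => b (pi v)), lab; split.
- exact: subset_trans GE1 (subset_trans E1E EH).
- split.
  + by move=> e /labP[].
  + by move=> e f v eG fG ve vf; rewrite -!chiE // (sameU e f).
  + move=> e f v eG fG ve vf ef; apply/negP => /eqP labef.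
    have : f \in clashing_edges pi g b E1 e.
      rewrite inE (subsetP GE1 _ fG) eq_sym ef /=; apply/set0Pn; exists (pi v).
      by rewrite inE; apply/eqP/sameU.
    move=> clash; move: (eG); rewrite inE => /andP[_ /and3P[_ /forall_inP/(_ _ clash)/negP + _]].
    by apply; rewrite (labP e eG).2 (labP f fG).2 labef.
  + move=> e f u v eG fG ue uf ve buv.
    by apply: (unit_of_part (esym (sameU e f u eG fG ue uf)) ve).
  move=> e i eG; have eE := subsetP E1E _ (subsetP GE1 _ eG).
  have -> : [set v in e | b (pi v) == i] = part pi e [set j | b j == i].
    by apply/setP => v; rewrite !inE.
  rewrite (card_part pi_onto pi_inj _ eE) -[ltnRHS]card_ord -cardsT.
  apply: proper_card; rewrite properT; apply: contraNneq b01 => /setP bi.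
  by move: (bi i0) (bi i1); rewrite !inE => /eqP-> /eqP->.
have E_E1 : #|edges H| <= r ^ r * (r ^ r * #|E1|).
  by apply: leq_trans bigE _; rewrite leq_mul2l -[#|E|]mul1n bigE1 orbT.
have := leq_mul (leqnn #|J|) E_E1; have := leq_mul (leqnn (r ^ r * r ^ r)) bigG.
move: (r ^ r) (#|X| ^ r) #|J| #|G| #|E1| #|edges H| => R Q j m n k; nia.
Qed.

(** * Behrend sets in finite fields *)

Import Order.TTheory GRing.Theory Num.Theory.
Import VectorInternalTheory.
Local Open Scope ring_scope.

(** Strict convexity, as for points on a sphere, with weights of total at most [M]. Only [x] is
    identified because [b] and [c] may vanish. *)
Definition convex_free (M : nat) (V : zmodType) (A : V -> Prop) : Prop :=
  forall (a b c : nat) (x y z w : V), A x -> A y -> A z -> A w ->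
    (0 < a)%N -> (a + b + c <= M)%N ->
    x *+ a + y *+ b + z *+ c = w *+ (a + b + c) -> x = w.

(* [a |f - l|^2 + b |g - l|^2 + c |k - l|^2 = 0] *)
Lemma sphere_convex (h : nat) (R : nat) (a b c : nat) (f g k l : 'I_h -> nat) :
    (0 < a)%N ->
    (\sum_i f i ^ 2 = R)%N -> (\sum_i g i ^ 2 = R)%N ->
    (\sum_i k i ^ 2 = R)%N -> (\sum_i l i ^ 2 = R)%N ->
    (forall i, a * f i + b * g i + c * k i = (a + b + c) * l i)%N ->
  f =1 l.
Proof.
move=> a_gt0 Sf Sg Sk Sl lin.
pose t i : int := a%:Z * ((f i)%:Z - (l i)%:Z) ^+ 2 + b%:Z * ((g i)%:Z - (l i)%:Z) ^+ 2
   + c%:Z * ((k i)%:Z - (l i)%:Z) ^+ 2.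
have tE i : t i = a%:Z * (f i ^ 2)%N%:Z + b%:Z * (g i ^ 2)%N%:Z
   + c%:Z * (k i ^ 2)%N%:Z - (a + b + c)%N%:Z * (l i ^ 2)%N%:Z.
  have {}lin : a%:Z * (f i)%:Z + b%:Z * (g i)%:Z + c%:Z * (k i)%:Z
      = (a%:Z + b%:Z + c%:Z) * (l i)%:Z by have := lin i; lia.
  rewrite /t !PoszD -!mulnn !PoszM.
  transitivity (a%:Z * ((f i)%:Z * (f i)%:Z) + b%:Z * ((g i)%:Z * (g i)%:Z)
      + c%:Z * ((k i)%:Z * (k i)%:Z) + (a%:Z + b%:Z + c%:Z) * ((l i)%:Z * (l i)%:Z)
      - 2 * (l i)%:Z * (a%:Z * (f i)%:Z + b%:Z * (g i)%:Z + c%:Z * (k i)%:Z)).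
    by ring.
  by rewrite lin; ring.
have St : \sum_i t i = 0.
  rewrite (eq_bigr _ (fun i _ => tE i)) big_split /= sumrN !big_split /= -!mulr_sumr.
  have nat_int (u : 'I_h -> nat) : \sum_i (u i)%:Z = (\sum_i u i)%N%:Z.
    by rewrite -natz natr_sum; apply: eq_bigr => i _; rewrite natz.
  by rewrite !nat_int Sf Sg Sk Sl !PoszD; ring.
have t_ge0 i : 0 <= t i.
  by rewrite /t !addr_ge0 // mulr_ge0 // sqr_ge0.
move=> i.
have ti0 : t i = 0 by apply: psumr_eq0P St i isT.
have : a%:Z * ((f i)%:Z - (l i)%:Z) ^+ 2 = 0.
  apply/eqP; rewrite eq_le mulr_ge0 ?sqr_ge0 // andbT -ti0 /t -addrA lerDl.
  by rewrite addr_ge0 // mulr_ge0 // sqr_ge0.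
move/eqP; rewrite mulf_eq0 sqrf_eq0 subr_eq0; lia.
Qed.

(** With digits below [d] and [M * d <= p] there is no wrap-around, so the relation holds in the
    naturals, where [sphere_convex] applies. *)
Lemma behrend_digits (p d M h R : nat) (f g k l : {ffun 'I_h -> 'I_d})
   (vec := fun f : {ffun 'I_h -> 'I_d} => \row_i (f i)%:R : 'rV['F_p]_h) (a b c : nat) :
    prime p -> (M * d <= p)%N -> (0 < a)%N -> (a + b + c <= M)%N ->
    (\sum_i f i ^ 2 = R)%N -> (\sum_i g i ^ 2 = R)%N ->
    (\sum_i k i ^ 2 = R)%N -> (\sum_i l i ^ 2 = R)%N ->
  vec f *+ a + vec g *+ b + vec k *+ c = vec l *+ (a + b + c) -> vec f = vec l.
Proof.
move=> pr_p Mdp a_gt0 abcM Sf Sg Sk Sl E.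
suff fl : (fun i => f i : nat) =1 (fun i => l i : nat).
  by apply/rowP => i; rewrite !mxE fl.
apply: (sphere_convex a_gt0 Sf Sg Sk Sl (b := b) (c := c)) => i.
move/rowP: E => /(_ i); rewrite !(mulmxnE, mxE) -!mulrnA -!natrD.
move=> /(congr1 (fun x : 'F_p => x : nat)).
rewrite /= !val_Fp_nat // !modn_small.
- by lia.
- have := ltn_ord (l i); nia.
- have := ltn_ord (f i); have := ltn_ord (g i); have := ltn_ord (k i); nia.
Qed.

Lemma pigeonhole (T : finType) (n : nat) (f : T -> nat) (S : {set T}) :
  (forall x, x \in S -> f x < n)%N ->
  (0 < n)%N -> exists2 k, (k < n)%N & (#|S| <= n * #|[set x in S | f x == k]|)%N.
Proof.
move=> fn n_gt0.
have [/existsP[k Hk]|/existsPn H] :=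
  boolP [exists k : 'I_n, (#|S| <= n * #|[set x in S | f x == k]|)%N].
  by exists k.
have: (\sum_(k < n) #|[set x in S | f x == k]| = #|S|)%N.
  rewrite -sum1_card (partition_big (fun x => inord (f x) : 'I_n.-1.+1) xpredT) //= .
  case: n fn n_gt0 {H} => //= n fn _; apply: eq_bigr => k _.
  rewrite -sum1_card; apply: eq_bigl => x; rewrite inE.
  case xS: (x \in S) => //=; rewrite -val_eqE /= inordK //; exact: fn.
move=> E.
have [S0|S_gt0] := posnP #|S|; first by exists 0%N; rewrite ?S0.
have : (n * \sum_(k < n) #|[set x in S | f x == k]| <= n * #|S|.-1)%N.
  rewrite big_distrr /=.
  have -> : (n * #|S|.-1 = \sum_(k < n) #|S|.-1)%N by rewrite sum_nat_const card_ord.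
  by apply: leq_sum => k _; have := H k; rewrite -ltnNge; lia.
rewrite E leq_pmul2l //; lia.
Qed.

(** Behrend's construction, carried from row vectors over ['F_p] to the field of order [p ^ h]:
    pigeonhole on the squared norm finds a sphere with many of the [d ^ h] digit vectors. *)
Lemma behrend_field (p d M h : nat) :
    prime p -> (0 < d)%N -> (0 < h)%N -> (0 < M)%N -> (M * d <= p)%N ->
  exists (F : finFieldType) (A : {set F}),
    [/\ #|F| = (p ^ h)%N, p \in [pchar F], convex_free M (fun x => x \in A)
      & (d ^ h <= 2 ^ h * d ^ 2 * #|A|)%N].
Proof.
move=> pr_p d_gt0 h_gt0 M_gt0 Mdp.
have [F chp cardF] := pPrimePowerField pr_p h_gt0.
pose L : vectType 'F_p := pPrimeCharType chp.
have dimL : \dim {:L} = h.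
  have := card_vspace {:L}; rewrite card_Fp //.
  have -> : #|{:L}%VS| = #|F| by apply: eq_card => x; rewrite memvf.
  by rewrite cardF => /eqP; rewrite eqn_exp2l ?prime_gt1 // => /eqP.
rewrite dimvf in dimL.
pose vec (f : {ffun 'I_h -> 'I_d}) : 'rV['F_p]_h := \row_i (f i)%:R.
pose emb (v : 'rV['F_p]_h) : F := r2v (castmx (erefl, esym dimL) v) : L.
have emb_inj : injective emb.
  move=> u v E; apply: (can_inj (castmxK erefl (esym dimL))).
  exact: (can_inj (@r2vK _ L) E).
have castD u v : castmx (erefl, esym dimL) (u + v) =
    castmx (erefl, esym dimL) u + castmx (erefl, esym dimL) v :> 'rV['F_p]_(dim L).
  by case: _ / (esym dimL) => //=; rewrite !castmx_id.
have embD u v : emb (u + v) = emb u + emb v.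
  have r2vD (x y : 'rV['F_p]_(dim L)) : r2v (x + y) =
      r2v x + r2v y :> L.
    exact: raddfD.
  by rewrite /emb castD; exact: r2vD.
have embM u k : emb (u *+ k) = emb u *+ k.
  elim: k => [|k IHk]; last by rewrite !mulrS embD IHk.
  by apply: (addrI (emb 0)); rewrite -embD !mulr0n !addr0.
have dp : (d <= p)%N by apply: leq_trans Mdp; rewrite leq_pmull.
have vec_inj : injective vec.
  move=> f g /rowP E; apply/ffunP => i; apply: val_inj.
  move: (E i); rewrite !mxE => /(congr1 (fun x : 'F_p => x : nat)).
  by rewrite /= !val_Fp_nat // !modn_small // (leq_trans (ltn_ord _)).
pose N (f : {ffun 'I_h -> 'I_d}) := (\sum_i f i ^ 2)%N.
have N_lt f : f \in [set: {ffun 'I_h -> 'I_d}] -> (N f < 2 ^ h * d ^ 2)%N.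
  move=> _; apply: (@leq_ltn_trans (h * d.-1 ^ 2)).
    apply: (@leq_trans (\sum_(i < h) d.-1 ^ 2)%N); last by rewrite sum_nat_const card_ord.
    by apply: leq_sum => i _; rewrite leq_exp2r // -ltnS prednK.
  (* Replacing [h] by [2 ^ h] gives the loss the exponential form that is absorbed at the end. *)
  have hh : (h < 2 ^ h)%N by exact: ltn_expl.
  case: d d_gt0 {f N Mdp dp vec vec_inj} => //= d _.
  by rewrite -!mulnn; nia.
have [|R _] := pigeonhole N_lt; first by rewrite muln_gt0 !expn_gt0 d_gt0.
set S := [set f in _ | _]; rewrite cardsT card_ffun !card_ord => S_big.
exists F, [set emb (vec f) | f in S]; split=> //; last first.
  by rewrite card_imset // => f g /emb_inj/vec_inj.
move=> a b c x y z w /imsetP[f Sf ->] /imsetP[g Sg ->] /imsetP[k Sk ->] /imsetP[l Sl ->].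
move=> a_gt0 abcM; rewrite -!embM -!embD => /emb_inj E; congr emb.
move: Sf Sg Sk Sl; rewrite !inE /= => /eqP Sf /eqP Sg /eqP Sk /eqP Sl.
exact: (behrend_digits pr_p Mdp a_gt0 abcM Sf Sg Sk Sl E).
Qed.

(** * Integer relations and the parabola *)

Lemma convex_free_int (M : nat) (V : zmodType) (A : V -> Prop) (a b c : int) (x y z w : V) :
    convex_free M A -> A x -> A y -> A z -> A w ->
    0 < a -> 0 <= b -> 0 <= c -> a + b + c <= M%:Z ->
  x *~ a + y *~ b + z *~ c = w *~ (a + b + c) -> x = w.
Proof.
move=> cvA Ax Ay Az Aw; case: a b c => [a|//] [b|//] [c|//] a_gt0 _ _ abcM.
rewrite -!PoszD -!pmulrn; apply: cvA => //; lia.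
Qed.

Lemma convex_free3 (M : nat) (V : zmodType) (A : V -> Prop) (a b c : int) (x y z : V) :
    convex_free M A -> A x -> A y -> A z ->
    a != 0 -> b != 0 -> c != 0 -> a + b + c = 0 ->
    `|a| + `|b| + `|c| <= M%:Z ->
  x *~ a + y *~ b + z *~ c = 0 -> x = y /\ y = z.
Proof.
move=> cvA.
have key (a' b' : int) (x' y' z' : V) : A x' -> A y' -> A z' -> 0 < a' -> 0 < b' ->
    a' + b' <= M%:Z -> x' *~ a' + y' *~ b' = z' *~ (a' + b') -> x' = z' /\ y' = z'.
  move=> Ax Ay Az a_gt0 b_gt0 abM E; split.
    apply: (convex_free_int cvA Ax Ay Az Az a_gt0 (ltW b_gt0) (lexx 0)).
      by rewrite addr0.
    by rewrite mulr0z !addr0.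
  apply: (convex_free_int cvA Ay Ax Az Az b_gt0 (ltW a_gt0) (lexx 0)).
    by rewrite addr0 addrC.
  by rewrite mulr0z !addr0 addrC [b' + a']addrC.
(* Some two coefficients have the same sign, which makes the third point a convex
   combination of the other two. *)
have same (a' b' c' : int) (x' y' z' : V) : A x' -> A y' -> A z' ->
    0 < a' * b' -> a' + b' + c' = 0 ->
    `|a'| + `|b'| <= M%:Z -> x' *~ a' + y' *~ b' + z' *~ c' = 0 -> x' = z' /\ y' = z'.
  move=> Ax Ay Az ab abc abM; have -> : c' = - (a' + b') by lia.
  rewrite mulrNz => /eqP; rewrite subr_eq0 => /eqP E.
  have [a_gt0|a_le0] := ltP 0 a'.
    have b_gt0 : 0 < b' by nia.
    by apply: (key _ _ _ _ _ Ax Ay Az a_gt0 b_gt0 _ E); lia.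
  have b_lt0 : 0 < - b' by nia.
  have a_lt0 : 0 < - a' by nia.
  apply: (key _ _ _ _ _ Ax Ay Az a_lt0 b_lt0); first by lia.
  by rewrite -opprD !mulrNz -opprD E.
move=> Ax Ay Az a0 b0 c0 abc abcM E.
have [ab|ab] := ltP 0 (a * b).
  by have [|-> ->] := same a b c x y z Ax Ay Az ab abc _ E; [lia|].
have [bc|bc] := ltP 0 (b * c).
  have E' : y *~ b + z *~ c + x *~ a = 0 by rewrite addrC addrA.
  by have [||-> ->] := same b c a y z x Ay Az Ax bc _ _ E'; [lia|lia|].
have E' : x *~ a + z *~ c + y *~ b = 0 by rewrite addrAC.
by have [|||-> ->] := same a c b x z y Ax Az Ay _ _ _ E'; [nia|lia|lia|].
Qed.

Lemma intr_neq0_pchar (F : fieldType) (p : nat) (k : int) :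
  p \in [pchar F] -> k != 0 -> `|k| < p%:Z -> k%:~R != 0 :> F.
Proof.
move=> chp k0 kp; have : (`|k|%N %:R != 0 :> F).
  rewrite -(dvdn_pcharf chp); apply/negP => /dvdn_leq; lia.
case: k {k0 kp} => n; first by rewrite absz_nat.
by rewrite NegzE abszN absz_nat mulrNz oppr_eq0.
Qed.

Section Parabola.
Variables (F : fieldType) (p M K : nat) (A : F -> Prop).
Hypotheses (chp : p \in [pchar F]) (cvA : convex_free M A).
Hypotheses (Mp : (M < p)%N) (KM : (16 * K ^ 2 <= M)%N).

(* Eliminating [z] leaves a binary quadratic form in [x - w] and [y - w] whose
   discriminant is [b1 * b2 * b3 * b4] up to a square, hence a product of two linear
   forms with integer coefficients. *)
Lemma parabola_square (b1 b2 b3 b4 m : int) (x y z w : F) :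
    A x -> A y -> A w ->
    b1 + b2 + b3 + b4 = 0 -> b1 != 0 -> b1 + b3 != 0 ->
    b1 * b2 * b3 * b4 = m ^+ 2 ->
    `|b1| <= K%:Z -> `|b2| <= K%:Z -> `|b3| <= K%:Z -> `|b4| <= K%:Z ->
    x *~ b1 + y *~ b2 + z *~ b3 + w *~ b4 = 0 ->
    x ^+ 2 *~ b1 + y ^+ 2 *~ b2 + z ^+ 2 *~ b3 + w ^+ 2 *~ b4 = 0 ->
  x = y \/ w = x.
Proof.
have normM_le (c d : int) (C D : nat) : `|c| <= C%:Z -> `|d| <= D%:Z -> `|c * d| <= (C * D)%N%:Z.
  by move=> cC dD; rewrite normrM PoszM ler_pM.
move=> Ax Ay Aw sb b10 b13 disc b1K b2K b3K b4K lin quad.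
have b4E : b4 = - (b1 + b2 + b3) by lia.
have mK : `|m| <= (K ^ 2)%N%:Z.
  have := normM_le _ _ _ _ (normM_le _ _ _ _ b1K b2K) (normM_le _ _ _ _ b3K b4K).
  rewrite mulrA disc -mulnn normrX => H; rewrite -(ler_pXn2r (ltn0Sn 1)) ?nnegrE //.
pose a := b1 * (b1 + b3).
have a0 : a != 0 by rewrite mulf_neq0.
have prod0 : (x *~ a + y *~ (b1 * b2 + m) + w *~ (- (a + (b1 * b2 + m)))) *
             (x *~ a + y *~ (b1 * b2 - m) + w *~ (- (a + (b1 * b2 - m)))) = 0.
  move: lin quad; rewrite -!(mulrzl x, mulrzl y, mulrzl z, mulrzl w).
  rewrite -!(mulrzl (x ^+ 2), mulrzl (y ^+ 2), mulrzl (z ^+ 2), mulrzl (w ^+ 2)).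
  rewrite b4E /a !(intrD, intrN, intrM, mulrNz).
  have discF : m%:~R ^+ 2 = - (b1%:~R * b2%:~R * b3%:~R * (b1%:~R + b2%:~R + b3%:~R)) :> F.
    rewrite -rmorphXn /= -disc b4E !(intrD, intrN, intrM, mulrNz); ring.
  move: (b1%:~R) (b2%:~R) (b3%:~R) (m%:~R) discF => c1 c2 c3 d discF lin quad.
  set L := (X in X = 0) in lin; set S := (X in X = 0) in quad.
  (* Explicit certificate: the product of the two forms vanishes modulo [L], [S] and the
     discriminant relation. *)
  transitivity (c1 * (c1 + c3) *
       (c3 * (S - 2 * w * L) - L * (L - 2 * (c1 * (x - w) + c2 * (y - w))))
     - (d ^+ 2 + c1 * c2 * c3 * (c1 + c2 + c3)) * (y - w) ^+ 2).
    by rewrite /L /S; ring.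
  by rewrite lin quad discF; ring.
have b12 : `|b1 * b2| <= (K ^ 2)%N%:Z by rewrite -mulnn normM_le.
(* A relation with coefficient sum zero identifies two points directly if a coefficient vanishes,
   and through convex-freeness otherwise. *)
have conc b : `|b| <= (2 * K ^ 2)%N%:Z -> x *~ a + y *~ b + w *~ (- (a + b)) = 0 -> x = y \/ w = x.
  move=> bK E.
  have aK : `|a| <= (2 * K ^ 2)%N%:Z.
    apply: le_trans (normM_le _ _ K (2 * K)%N b1K _) _; first by lia.
    by rewrite mulnCA mulnn.
  have aF0 : a%:~R != 0 :> F by apply: (intr_neq0_pchar chp a0); lia.
  have [b0|b0] := eqVneq b 0.
    right; move: E; rewrite b0 mulr0z !addr0 mulrNz => /eqP; rewrite subr_eq0 => /eqP.
    by rewrite -(mulrzl x) -(mulrzl w) => /(mulfI aF0).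
  have [ab0|ab0] := eqVneq (- (a + b)) 0.
    left; move: E; have -> : b = - a by lia.
    rewrite subrr oppr0 mulr0z addr0 mulrNz => /eqP; rewrite subr_eq0 => /eqP.
    by rewrite -(mulrzl x) -(mulrzl y) => /(mulfI aF0).
  left; have [||->//] := convex_free3 cvA Ax Ay Aw a0 b0 ab0 _ _ E; lia.
by move/eqP: prod0; rewrite mulf_eq0 => /orP[] /eqP; apply: conc; lia.
Qed.
End Parabola.

(** * Dense tuple systems without short cycles *)

(* [{0, 2, 3, 27}] is a Sidon set for which two of the three cyclic products of
   differences, [2 * 25 * 24 * 3] and [3 * 25 * 1 * 27], are squares; the third
   has the convex sign pattern of [one_vs_three]. *)
Definition slope (i : nat) : int := [:: 0; 2; 3; 27]`_i.

(** Three coefficients have the same strict sign. If all four sum to zero, a linear relation makes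
    the remaining point a convex combination of the other three. *)
Definition one_vs_three (b1 b2 b3 b4 : int) : bool :=
  [|| (0 < b1 * b2) && (0 < b1 * b3), (0 < b1 * b2) && (0 < b1 * b4),
      (0 < b1 * b3) && (0 < b1 * b4) | (0 < b2 * b3) && (0 < b2 * b4)].

Lemma slope_le (i : nat) : 0 <= slope i <= 27.
Proof. by case: i => [|[|[|[|i]]]] //; rewrite /slope nth_default. Qed.

Lemma slope_inj (i j : nat) : (i < 4)%N -> (j < 4)%N -> i != j -> slope i - slope j != 0.
Proof.
move=> i4 j4.
have /allP/(_ i)/[!mem_iota]/(_ i4)/allP/(_ j)/[!mem_iota]/(_ j4)/implyP :
  all (fun i => all (fun j => (i != j) ==> (slope i - slope j != 0)) (iota 0 4)) (iota 0 4).
  by vm_compute.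
exact.
Qed.

Lemma slope_sidon (i j k l : nat) : (i < 4)%N -> (j < 4)%N -> (k < 4)%N -> (l < 4)%N ->
  [&& i != j, j != k, k != l & l != i] -> slope i - slope l + (slope k - slope j) != 0.
Proof.
move=> i4 j4 k4 l4.
have /allP/(_ i)/[!mem_iota]/(_ i4)/allP/(_ j)/[!mem_iota]/(_ j4)/allP/(_ k)/[!mem_iota]/(_ k4)
     /allP/(_ l)/[!mem_iota]/(_ l4)/implyP :
  all (fun i => all (fun j => all (fun k => all (fun l =>
    [&& i != j, j != k, k != l & l != i] ==> (slope i - slope l + (slope k - slope j) != 0))
    (iota 0 4)) (iota 0 4)) (iota 0 4)) (iota 0 4).
  by vm_compute.
exact.
Qed.

(** If opposite coordinates coincide, the coefficients pair off into opposite numbers and the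
    product is a square. For four distinct coordinates the check is finite. *)
Lemma slope_square (i j k l : nat) : (i < 4)%N -> (j < 4)%N -> (k < 4)%N -> (l < 4)%N ->
  let b1 := slope i - slope l in let b2 := slope j - slope i in
  let b3 := slope k - slope j in let b4 := slope l - slope k in
  [&& i != j, j != k, k != l & l != i] ->
  one_vs_three b1 b2 b3 b4 \/ exists m, b1 * b2 * b3 * b4 = m ^+ 2.
Proof.
move=> i4 j4 k4 l4 b1 b2 b3 b4 cyc.
have [ik|ik] := eqVneq i k; first by right; exists (b1 * b2); rewrite /b1 /b2 /b3 /b4 ik; ring.
have [jl|jl] := eqVneq j l; first by right; exists (b1 * b3); rewrite /b1 /b2 /b3 /b4 jl; ring.
have /allP/(_ i)/[!mem_iota]/(_ i4)/allP/(_ j)/[!mem_iota]/(_ j4)/allP/(_ k)/[!mem_iota]/(_ k4)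
     /allP/(_ l)/[!mem_iota]/(_ l4)/implyP :
  all (fun i => all (fun j => all (fun k => all (fun l => uniq [:: i; j; k; l] ==>
    let b1 := slope i - slope l in let b2 := slope j - slope i in
    let b3 := slope k - slope j in let b4 := slope l - slope k in
    [|| one_vs_three b1 b2 b3 b4, b1 * b2 * b3 * b4 == 45 ^+ 2 | b1 * b2 * b3 * b4 == 60 ^+ 2])
    (iota 0 4)) (iota 0 4)) (iota 0 4)) (iota 0 4).
  by vm_compute.
case/and4P: cyc => ij jk kl li /=.
rewrite !inE !negb_or ij ik jl jk kl eq_sym li => /(_ isT) /or3P[->|/eqP E|/eqP E]; [by left| |];
  by right; eexists; exact: E.
Qed.

(** * Linear families of tuples *)

Section LinearFamily.
Variables (r : nat) (V : zmodType) (I : Type) (phi : I -> V).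

Definition moving_point (y : V) (a : I) : {ffun 'I_r -> V} :=
  [ffun i : 'I_r => y + phi a *~ slope i].

Lemma moving_point_meet y1 y2 a1 a2 (i : 'I_r) :
  moving_point y1 a1 i = moving_point y2 a2 i ->
  y1 - y2 = phi a2 *~ slope i - phi a1 *~ slope i.
Proof.
by rewrite !ffunE => /eqP; rewrite -subr_eq0 opprD addrACA addr_eq0 opprB => /eqP.
Qed.

End LinearFamily.

Lemma one_vs_three_eq (M : nat) (V : zmodType) (A : V -> Prop) (b1 b2 b3 b4 : int) (x y z w : V) :
    convex_free M A -> A x -> A y -> A z -> A w ->
    one_vs_three b1 b2 b3 b4 -> b1 + b2 + b3 + b4 = 0 ->
    `|b1| + `|b2| + `|b3| + `|b4| <= M%:Z ->
  x *~ b1 + y *~ b2 + z *~ b3 + w *~ b4 = 0 -> x = y \/ w = x.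
Proof.
move=> cvA Ax Ay Az Aw.
have pos (c1 c2 c3 : int) (x1 x2 x3 x4 : V) : A x1 -> A x2 -> A x3 -> A x4 ->
    0 < c1 -> 0 < c2 -> 0 < c3 -> c1 + c2 + c3 <= M%:Z ->
    x1 *~ c1 + x2 *~ c2 + x3 *~ c3 = x4 *~ (c1 + c2 + c3) -> x1 = x4 /\ x2 = x4.
  move=> A1 A2 A3 A4 c1_gt0 c2_gt0 c3_gt0 cM E; split.
    by apply: (convex_free_int cvA A1 A2 A3 A4 c1_gt0 _ _ cM E); exact: ltW.
  apply: (convex_free_int cvA A2 A1 A3 A4 c2_gt0 (ltW c1_gt0) (ltW c3_gt0)).
    by rewrite [c2 + c1]addrC.
  by rewrite [x2 *~ c2 + _]addrC [c2 + c1]addrC.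
have key (c1 c2 c3 c4 : int) (x1 x2 x3 x4 : V) : A x1 -> A x2 -> A x3 -> A x4 ->
    0 < c1 * c2 -> 0 < c1 * c3 -> c1 + c2 + c3 + c4 = 0 ->
    `|c1| + `|c2| + `|c3| <= M%:Z ->
    x1 *~ c1 + x2 *~ c2 + x3 *~ c3 + x4 *~ c4 = 0 -> x1 = x4 /\ x2 = x4.
  move=> A1 A2 A3 A4 c12 c13 sc cM; have -> : c4 = - (c1 + c2 + c3) by lia.
  rewrite mulrNz => /eqP; rewrite subr_eq0 => /eqP E.
  have [c1_gt0|c1_le0] := ltP 0 c1.
    have c2_gt0 : 0 < c2 by nia.
    have c3_gt0 : 0 < c3 by nia.
    by apply: (pos _ _ _ _ _ _ _ A1 A2 A3 A4 c1_gt0 c2_gt0 c3_gt0 _ E); lia.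
  have c1_lt0 : 0 < - c1 by nia.
  have c2_lt0 : 0 < - c2 by nia.
  have c3_lt0 : 0 < - c3 by nia.
  apply: (pos _ _ _ _ _ _ _ A1 A2 A3 A4 c1_lt0 c2_lt0 c3_lt0); first by lia.
  by rewrite -!opprD !mulrNz -!opprD E.
move=> /or4P[] /andP[P1 P2] sb bM E; left.
- by have [|-> ->] := key b1 b2 b3 b4 x y z w Ax Ay Az Aw P1 P2 sb _ E; [lia|].
- have E' : x *~ b1 + y *~ b2 + w *~ b4 + z *~ b3 = 0 by rewrite addrAC.
  by have [||-> ->] := key b1 b2 b4 b3 x y w z Ax Ay Aw Az P1 P2 _ _ E'; [lia|lia|].
- have E' : x *~ b1 + z *~ b3 + w *~ b4 + y *~ b2 = 0 
    by rewrite -E addrAC; congr (_ + _); exact: addrAC.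
  by have [||-> _] := key b1 b3 b4 b2 x z w y Ax Az Aw Ay P1 P2 _ _ E'; [lia|lia|].
- have E' : y *~ b2 + z *~ b3 + w *~ b4 + x *~ b1 = 0 by rewrite addrC !addrA.
  by have [||-> _] := key b2 b3 b4 b1 y z w x Ay Az Aw Ax P1 P2 _ _ E'; [lia|lia|].
Qed.

Section Family.
Variables (r : nat) (V : finZmodType) (I : finType) (phi : I -> V) (A : {set I}).
Hypothesis r4 : (r <= 4)%N.
Hypothesis phi_dir : forall a b (k : int), a \in A -> b \in A ->
  k != 0 -> `|k| <= 27 -> phi a *~ k = phi b *~ k -> a = b.
Hypothesis phi_triangle : forall a1 a2 a3 (k1 k2 k3 : int),
  a1 \in A -> a2 \in A -> a3 \in A -> k1 != 0 -> k2 != 0 -> k3 != 0 ->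
  `|k1| <= 27 -> `|k2| <= 27 -> `|k3| <= 27 -> k1 + k2 + k3 = 0 ->
  phi a1 *~ k1 + phi a2 *~ k2 + phi a3 *~ k3 = 0 -> a1 = a2.

Definition moving_family : {set {ffun 'I_r -> V}} :=
  [set moving_point r phi y a | y in setT, a in A].

Let small (i : 'I_r) : (i < 4)%N. Proof. exact: leq_trans (ltn_ord i) r4. Qed.

Let slope_neq (i j : 'I_r) : i != j -> slope i - slope j != 0.
Proof. by move=> ij; apply: slope_inj => //; exact: small. Qed.

Let slope_bound (i j : 'I_r) : `|slope i - slope j| <= 27.
Proof. have := slope_le i; have := slope_le j; lia. Qed.

Lemma moving_meet_dir y1 y2 a1 a2 (i : 'I_r) : a1 = a2 ->
  moving_point r phi y1 a1 i = moving_point r phi y2 a2 i ->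
  moving_point r phi y1 a1 = moving_point r phi y2 a2.
Proof.
by move=> -> E; have := moving_point_meet E; rewrite subrr => /eqP; rewrite subr_eq0 => /eqP->.
Qed.

Lemma moving_meet2 y1 y2 a1 a2 (i j : 'I_r) : a1 \in A -> a2 \in A -> i != j ->
  moving_point r phi y1 a1 i = moving_point r phi y2 a2 i ->
  moving_point r phi y1 a1 j = moving_point r phi y2 a2 j -> a1 = a2.
Proof.
move=> A1 A2 ij Ei Ej; have {}Ei := moving_point_meet Ei; have {}Ej := moving_point_meet Ej.
apply: (phi_dir A1 A2 (slope_neq ij) (slope_bound i j)).
have -> : phi a1 *~ (slope i - slope j) =
    (phi a2 *~ slope i - (y1 - y2)) - (phi a2 *~ slope j - (y1 - y2)).
  by rewrite {1}Ei Ej !subKr mulrzBr.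
by rewrite mulrzBr; move: (y1 - y2) => d; rewrite opprB addrA subrK.
Qed.

Lemma moving_linear : linear_tuples moving_family.
Proof.
move=> _ _ i j /imset2P[y1 a1 _ A1 ->] /imset2P[y2 a2 _ A2 ->] ij Ei Ej.
exact: moving_meet_dir (moving_meet2 A1 A2 ij Ei Ej) Ei.
Qed.

Lemma card_moving_family : (1 < r)%N -> #|moving_family| = (#|V| * #|A|)%N.
Proof.
move=> r_gt1; rewrite /moving_family curry_imset2X card_in_imset ?cardsX ?cardsT //.
move=> [y1 a1] [y2 a2] /setXP[_ A1] /setXP[_ A2] /= E.
have a12 : a1 = a2.
  by apply: (@moving_meet2 y1 y2 _ _ (Ordinal (ltnW r_gt1)) (Ordinal r_gt1)) => //; rewrite E.
congr (_, _) => //; apply/eqP; rewrite -subr_eq0.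
by rewrite (@moving_point_meet r _ _ phi y1 y2 a1 a2 (Ordinal r_gt1)) ?E // a12 subrr.
Qed.

(** Adding the three meeting relations cancels the base points and leaves a relation between
    directions, with slope differences as coefficients. *)
Lemma moving_triangle_free : triangle_free_tuples moving_family.
Proof.
move=> _ _ _ i j k /imset2P[y1 a1 _ A1 ->] /imset2P[y2 a2 _ A2 ->] /imset2P[y3 a3 _ A3 ->].
move=> /and3P[ij jk ki] Ei Ej Ek; apply: moving_meet_dir (Ei).
have {}Ei := moving_point_meet Ei; have {}Ej := moving_point_meet Ej.
have {}Ek := moving_point_meet Ek.
have k1 : slope i - slope k != 0 by rewrite slope_neq // eq_sym.
have k2 : slope j - slope i != 0 by rewrite slope_neq // eq_sym.
have k3 : slope k - slope j != 0 by rewrite slope_neq // eq_sym.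
apply: (phi_triangle A1 A2 A3 k1 k2 k3); rewrite ?slope_bound //; first by ring.
have : (y1 - y2) + (y2 - y3) + (y3 - y1) = 0 by rewrite !addrA !subrK subrr.
rewrite Ei Ej Ek => /eqP; rewrite -oppr_eq0 !opprD !opprK => /eqP <-.
by rewrite !mulrzBr (AC (2*2*2) ((4*1)*(6*3)*(2*5))).
Qed.

(** The relations telescope as for triangles. The Sidon property of the slopes gives [b1 + b3 != 0],
    and [slope_square] the dichotomy. *)
Lemma moving_quad_free :
    (forall a1 a2 a3 a4 (b1 b2 b3 b4 : int),
      a1 \in A -> a2 \in A -> a3 \in A -> a4 \in A ->
      b1 + b2 + b3 + b4 = 0 -> b1 != 0 -> b1 + b3 != 0 ->
      `|b1| <= 27 -> `|b2| <= 27 -> `|b3| <= 27 -> `|b4| <= 27 ->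
      one_vs_three b1 b2 b3 b4 \/ (exists m, b1 * b2 * b3 * b4 = m ^+ 2) ->
      phi a1 *~ b1 + phi a2 *~ b2 + phi a3 *~ b3 + phi a4 *~ b4 = 0 ->
      a1 = a2 \/ a4 = a1) ->
  quad_free_tuples moving_family.
Proof.
move=> phi_quad _ _ _ _ i j k l /imset2P[y1 a1 _ A1 ->] /imset2P[y2 a2 _ A2 ->]
  /imset2P[y3 a3 _ A3 ->] /imset2P[y4 a4 _ A4 ->].
move=> cyc Ei Ej Ek El.
suff: a1 = a2 \/ a4 = a1.
  by case=> E; [left; apply: moving_meet_dir E Ei | right; apply: moving_meet_dir E El].
have /and4P[ij jk kl li] := cyc.
apply: (phi_quad a1 a2 a3 a4 (slope i - slope l) (slope j - slope i) (slope k - slope j)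
  (slope l - slope k)); rewrite ?slope_bound //.
- by ring.
- by rewrite slope_neq // eq_sym.
- exact: slope_sidon.
- exact: slope_square.
have {}Ei := moving_point_meet Ei; have {}Ej := moving_point_meet Ej.
have {}Ek := moving_point_meet Ek; have {}El := moving_point_meet El.
have : (y1 - y2) + (y2 - y3) + (y3 - y4) + (y4 - y1) = 0 by rewrite !addrA !subrK subrr.
rewrite Ei Ej Ek El => /eqP; rewrite -oppr_eq0 !opprD !opprK => /eqP <-.
by rewrite !mulrzBr (AC (2*2*2*2) ((4*1)*(6*3)*(8*5)*(2*7))).
Qed.

End Family.

(* Bounds all the coefficients produced from slopes at most 27. *)
Definition width : nat := (16 * 27 ^ 2)%N.

(** Restricting digits to values below [p %/ width] loses at most a factor [2 * width] per digit;
    the choice of a sphere costs at most [2 ^ h * p ^ 2]. *)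
Lemma dense_convex_free (p h : nat) : prime p -> (width < p)%N -> (0 < h)%N ->
  exists (F : finFieldType) (A : {set F}),
    [/\ #|F| = (p ^ h)%N, p \in [pchar F], convex_free width (fun x => x \in A)
      & (p ^ h <= p ^ 2 * (4 * width) ^ h * #|A|)%N].
Proof.
have : (0 < width)%N by [].
move: width => M M_gt0 pr_p Mp h_gt0.
have d_gt0 : (0 < p %/ M)%N by rewrite divn_gt0 // ltnW.
have Mdp : (M * (p %/ M) <= p)%N by rewrite mulnC leq_trunc_div.
have [F [A [cF chp cvA A_big]]] := behrend_field pr_p d_gt0 h_gt0 M_gt0 Mdp.
exists F, A; split=> //.
have pd : (p <= 2 * M * (p %/ M))%N.
  by rewrite {1}(divn_eq p M); have := ltn_pmod p M_gt0; nia.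
apply: (@leq_trans ((2 * M * (p %/ M)) ^ h)); first by rewrite leq_exp2r.
rewrite expnMn.
apply: leq_trans (leq_mul (leqnn _) A_big) _.
have -> : (4 * M = 2 * M * 2)%N by lia.
rewrite [in X in (_ <= X)%N]expnMn !mulnA leq_mul2r; apply/orP; right.
have dp := leq_div p M.
rewrite -mulnA -(mulnA (p ^ 2)%N) [leqRHS]mulnC leq_mul2l -mulnn leq_mul ?orbT //.
Qed.

(** * Families over finite fields *)

Section FieldFamilies.
Variables (F : finFieldType) (p : nat) (A : {set F}).
Hypotheses (chp : p \in [pchar F]) (Mp : (width < p)%N).
Hypothesis cvA : convex_free width (fun x => x \in A).

Lemma mulrz_cancel (a b : F) (k : int) :
  k != 0 -> `|k| <= 27 -> a *~ k = b *~ k -> a = b.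
Proof.
move=> k0 kM; rewrite -(mulrzl a) -(mulrzl b); apply: mulfI.
apply: (intr_neq0_pchar chp k0); have : (27 < p)%N by apply: leq_trans Mp.
lia.
Qed.

Lemma line_triangle (a1 a2 a3 : F) (k1 k2 k3 : int) :
  a1 \in A -> a2 \in A -> a3 \in A -> k1 != 0 -> k2 != 0 -> k3 != 0 ->
  `|k1| <= 27 -> `|k2| <= 27 -> `|k3| <= 27 -> k1 + k2 + k3 = 0 ->
  a1 *~ k1 + a2 *~ k2 + a3 *~ k3 = 0 -> a1 = a2.
Proof.
move=> A1 A2 A3 k10 k20 k30 k1M k2M k3M sk E.
have [|//] := convex_free3 cvA A1 A2 A3 k10 k20 k30 sk _ E.
by rewrite /width; clear -k1M k2M k3M; lia.
Qed.

Definition plane : finZmodType :=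
  HB.pack (F * F)%type (Finite.on (F * F)%type) (GRing.Zmodule.on (F * F)%type).

Definition parabola (a : F) : plane := (a, a ^+ 2).

Let fstz (u : plane) (k : int) : (u *~ k).1 = u.1 *~ k.
Proof. exact: (raddfMz fst). Qed.
Let sndz (u : plane) (k : int) : (u *~ k).2 = u.2 *~ k.
Proof. exact: (raddfMz snd). Qed.

Lemma parabola_dir (a b : F) (k : int) : a \in A -> b \in A ->
  k != 0 -> `|k| <= 27 -> parabola a *~ k = parabola b *~ k -> a = b.
Proof. by move=> _ _ k0 kM /(congr1 fst); rewrite !fstz; apply: mulrz_cancel. Qed.

Lemma parabola_triangle (a1 a2 a3 : F) (k1 k2 k3 : int) :
  a1 \in A -> a2 \in A -> a3 \in A -> k1 != 0 -> k2 != 0 -> k3 != 0 ->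
  `|k1| <= 27 -> `|k2| <= 27 -> `|k3| <= 27 -> k1 + k2 + k3 = 0 ->
  parabola a1 *~ k1 + parabola a2 *~ k2 + parabola a3 *~ k3 = 0 -> a1 = a2.
Proof.
move=> A1 A2 A3 k10 k20 k30 k1M k2M k3M sk /(congr1 fst); rewrite /= !fstz.
exact: line_triangle.
Qed.

(** Under the sign pattern the first coordinates suffice; in the square case the second coordinates
    supply the quadratic relation. *)
Lemma parabola_quad (a1 a2 a3 a4 : F) (b1 b2 b3 b4 : int) :
  a1 \in A -> a2 \in A -> a3 \in A -> a4 \in A ->
  b1 + b2 + b3 + b4 = 0 -> b1 != 0 -> b1 + b3 != 0 ->
  `|b1| <= 27 -> `|b2| <= 27 -> `|b3| <= 27 -> `|b4| <= 27 ->
  one_vs_three b1 b2 b3 b4 \/ (exists m, b1 * b2 * b3 * b4 = m ^+ 2) ->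
  parabola a1 *~ b1 + parabola a2 *~ b2 + parabola a3 *~ b3 + parabola a4 *~ b4 = 0 ->
  a1 = a2 \/ a4 = a1.
Proof.
move=> A1 A2 A3 A4 sb b10 b13 b1M b2M b3M b4M cond E.
move: (congr1 fst E) (congr1 snd E); rewrite /= !fstz !sndz /= => lin quad.
case: cond => [ovt|[m disc]].
  by apply: (one_vs_three_eq cvA A1 A2 A3 A4 ovt sb _ lin); rewrite /width; lia.
exact: (parabola_square chp cvA Mp (K := 27) _ A1 A2 A4 sb b10 b13 disc b1M b2M b3M b4M lin quad).
Qed.

End FieldFamilies.

Lemma dense_triangle_free (p h : nat) : prime p -> (width < p)%N -> (0 < h)%N ->
  exists (X : finType) (J : {set {ffun 'I_3 -> X}}),
    [/\ #|X| = (p ^ h)%N, linear_tuples J, triangle_free_tuples J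
      & (p ^ h * p ^ h <= p ^ 2 * (4 * width) ^ h * #|J|)%N].
Proof.
move=> pr_p Mp h_gt0.
have [F [A [cF chp cvA A_big]]] := dense_convex_free pr_p Mp h_gt0.
have dir (a b : F) (k : int) (_ : a \in A) (_ : b \in A) := @mulrz_cancel F p chp Mp a b k.
have tri := @line_triangle F A cvA.
exists F, (moving_family 3 id A); split=> //.
- exact: moving_linear.
- exact: moving_triangle_free.
rewrite card_moving_family // cF mulnCA leq_mul2l; apply/orP; right.
exact: A_big.
Qed.

Lemma dense_quad_free (r p h : nat) : (1 < r <= 4)%N ->
  prime p -> (width < p)%N -> (0 < h)%N ->
  exists (X : finType) (J : {set {ffun 'I_r -> X}}),
    [/\ #|X| = (p ^ (2 * h))%N, linear_tuples J, triangle_free_tuples J, quad_free_tuples J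
      & (p ^ (2 * h) * p ^ h <= p ^ 2 * (4 * width) ^ h * #|J|)%N].
Proof.
move=> /andP[r_gt1 r4] pr_p Mp h_gt0.
have [F [A [cF chp cvA A_big]]] := dense_convex_free pr_p Mp h_gt0.
have dir := @parabola_dir F p A chp Mp.
have tri := @parabola_triangle F A cvA.
have cFF : #|plane F| = (p ^ (2 * h))%N by rewrite card_prod cF -expnD addnn mul2n.
exists (plane F), (moving_family r (@parabola F) A); split=> //.
- exact: moving_linear.
- exact: moving_triangle_free.
- by apply: moving_quad_free => //; exact: parabola_quad chp Mp cvA.
by rewrite card_moving_family // cFF mulnCA leq_mul2l A_big orbT.
Qed.

(** * Asymptotics *)

(** In the application [y] is the order of the field, [y ^ k] the number of points, [z] the Behrend
    loss and [m = r - 1]. The last inequality bounds [e] by [K1 * z * y ^ (k * m - 1) * x], where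
    [y] is at most of order [Delta ^ (1 / (k * m))] and [z] is at most the [N]-th root of [y]. *)
Lemma eventually_powR (R : realType) (k m N : nat) (K1 K2 eps : R) :
    (0 < k)%N -> (0 < m)%N -> (0 < N)%N -> 0 < K1 -> 0 < K2 -> N%:R^-1 < eps ->
  exists Delta0 : nat, forall Delta : nat, (Delta0 <= Delta)%N ->
    forall y z e x : R, 1 <= y -> 0 <= z -> 0 <= e -> 0 <= x ->
      z ^+ N <= y -> y ^+ k <= K2 * Delta%:R `^ (m%:R^-1) ->
      e * y ^+ k.+1 <= K1 * z * y ^+ (k * m.+1) * x ->
    Delta%:R `^ (- (1 - (k * m)%:R^-1) - eps) * e <= x.
Proof.
move=> k_gt0 m_gt0 N_gt0 K1_gt0 K2_gt0 Neps.
have kR : 0 < k%:R :> R by rewrite ltr0n.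
have mR : 0 < m%:R :> R by rewrite ltr0n.
have NR : 0 < N%:R :> R by rewrite ltr0n.
have kmR : 1 <= k%:R * m%:R :> R by rewrite -natrM ler1n muln_gt0 k_gt0.
pose beta : R := k%:R * m%:R - 1 + N%:R^-1.
have beta_ge0 : 0 <= beta by rewrite addr_ge0 ?subr_ge0 ?invr_ge0 // ltW.
pose K := K1 * K2 `^ (beta / k%:R).
have K_gt0 : 0 < K by rewrite mulr_gt0 ?powR_gt0.
(* What remains of [eps] after paying for [z]; [Delta0] is chosen so that [Delta ^ gam] absorbs the
   constant [K]. *)
pose gam := eps - (N%:R * (k%:R * m%:R))^-1.
have gam_gt0 : 0 < gam.
  rewrite subr_gt0; apply: le_lt_trans Neps.
  by rewrite lef_pV2 ?posrE ?mulr_gt0 // ler_peMr // ltW.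
exists (Num.bound (K `^ gam^-1)).+1 => Delta DD y z e x y1 z0 e0 x0 zy yD ineq.
have D1 : 1 <= Delta%:R :> R by rewrite ler1n (leq_trans _ DD).
have D0 : 0 < Delta%:R :> R by apply: lt_le_trans D1.
have y0 : 0 < y by apply: lt_le_trans y1.
have KD : K <= Delta%:R `^ gam.
  have -> : K = (K `^ gam^-1) `^ gam by rewrite -powRrM mulVf ?powRr1 ?gt_eqF // ltW.
  apply: ge0_ler_powR; rewrite ?nnegrE ?powR_ge0 ?(ltW D0) ?(ltW gam_gt0) //.
  apply: le_trans (ltW (archi_boundP (powR_ge0 _ _))) _.
  by rewrite ler_nat ltnW.
have zle : z <= y `^ N%:R^-1.
  have -> : z = (z ^+ N) `^ N%:R^-1.
    by rewrite -powR_mulrn // -powRrM divff ?powRr1 ?gt_eqF.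
  by apply: ge0_ler_powR; rewrite ?nnegrE ?exprn_ge0 ?invr_ge0 // ltW.
have step1 : e <= K1 * y `^ beta * x.
  have yk_gt0 : 0 < y ^+ k.+1 by rewrite exprn_gt0.
  rewrite -(ler_pM2r yk_gt0); apply: le_trans ineq _.
  have -> : K1 * y `^ beta * x * y ^+ k.+1 = K1 * y `^ N%:R^-1 * y ^+ (k * m.+1) * x.
    have -> : K1 * y `^ beta * x * y ^+ k.+1 = K1 * (y `^ beta * y ^+ k.+1) * x by ring.
    rewrite -!mulrA; congr (_ * _); rewrite !mulrA; congr (_ * _).
    rewrite -!powR_mulrn ?(ltW y0) // -!powRD ?(gt_eqF y0) ?implybT //; congr (_ `^ _).
    by rewrite /beta mulnS natrD natrM -addn1 natrD; ring.
  rewrite ler_wpM2r // ler_wpM2r ?exprn_ge0 ?(ltW y0) // ler_wpM2l // ltW //.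
have step2 : y `^ beta <= K2 `^ (beta / k%:R) * Delta%:R `^ (beta / (k%:R * m%:R)).
  have -> : y `^ beta = (y ^+ k) `^ (beta / k%:R).
    by rewrite -powR_mulrn ?(ltW y0) // -powRrM mulrCA divff ?mulr1 ?gt_eqF.
  have -> : beta / (k%:R * m%:R) = m%:R^-1 * (beta / k%:R).
    by rewrite invfM; ring.
  rewrite (powRrM Delta%:R) -powRM ?powR_ge0 ?(ltW K2_gt0) //.
  apply: ge0_ler_powR yD; rewrite ?nnegrE ?divr_ge0 ?exprn_ge0 ?mulr_ge0 ?powR_ge0 //;
    exact: ltW.
have step3 : e <= K * Delta%:R `^ (beta / (k%:R * m%:R)) * x.
  apply: le_trans step1 _; rewrite ler_wpM2r // -mulrA ler_wpM2l //.
  exact: ltW.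
set c := Delta%:R `^ _; have c_ge0 : 0 <= c by exact: powR_ge0.
apply: le_trans (ler_wpM2l c_ge0 step3) _.
have -> : c * (K * Delta%:R `^ (beta / (k%:R * m%:R)) * x) =
    (c * Delta%:R `^ (beta / (k%:R * m%:R))) * K * x.
  by ring.
rewrite ler_piMl // /c -powRD ?(gt_eqF D0) ?implybT //.
have -> : - (1 - (k * m)%:R^-1) - eps + beta / (k%:R * m%:R) = - gam.
  rewrite /beta /gam natrM; field.
  by rewrite !gt_eqF.
by rewrite powRN mulrC ler_pdivrMr ?powR_gt0 // mul1r.
Qed.

(** The prime [p] is fixed by [eps]; the tuple system is then fitted to [Delta] through the least
    [h] for which [p ^ (k * h)] points suffice for [exists_labelling]. *)
Lemma relative_turan (R : realType) (r l k : nat) :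
    (1 < r)%N -> (0 < k)%N ->
    (forall p h : nat, prime p -> (width < p)%N -> (0 < h)%N ->
      exists (X : finType) (J : {set {ffun 'I_r -> X}}),
        [/\ #|X| = (p ^ (k * h))%N, linear_tuples J,
            (p ^ (k * h) * p ^ h <= p ^ 2 * (4 * width) ^ h * #|J|)%N
          & forall (T : finType) (G : {set {set T}}) col lab, labelling J G col lab ->
            forall (e : 'I_l -> {set T}) (v : 'I_l -> T), (forall i, e i \in G) ->
            injective e -> injective v ->
            (forall i, v i \in e i /\ v (ordS i) \in e i) -> False]) ->
  forall eps : R, 0 < eps -> exists Delta0 : nat, forall Delta : nat,
    (Delta0 <= Delta)%N ->
    forall (T : finType) (H : unigraph r T), (max_degree H <= Delta)%N ->
    Delta%:R `^ (- (1 - (k * (r - 1))%:R^-1) - eps) * #|edges H|%:R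
      <= (ex_number H (berge_cycle l r))%:R :> R.
Proof.
move=> r_gt1 k_gt0 dense eps eps_gt0.
pose N := (Num.bound eps^-1).+1.
have Neps : N%:R^-1 < eps.
  rewrite -[ltRHS]invrK ltf_pV2 ?posrE ?invr_gt0 ?ltr0n //.
  apply: lt_le_trans (archi_boundP _) _; first by rewrite invr_ge0 ltW.
  by rewrite ler_nat.
(* Exceeding the [N]-th power of [4 * width] makes the loss [(4 * width) ^ h] at most the [N]-th
   root of [p ^ h]. *)
have [p p_big pr_p] := prime_above (maxn width ((4 * width) ^ N)).
move: p_big; rewrite gtn_max => /andP[wp wNp].
have p_gt0 := prime_gt0 pr_p; have p_gt1 := prime_gt1 pr_p.
pose C := (2 * (2 ^ r * 2 + r * r))%N.
have C_gt0 : (0 < C)%N by rewrite /C; lia.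
have m_gt0 : (0 < r - 1)%N by rewrite subn_gt0.
have [||D0 D0P] := @eventually_powR R k (r - 1) N (p ^ 2 * (2 * r ^ r * r ^ r))%:R
  (p ^ k * C * 2)%:R eps k_gt0 m_gt0 isT _ _ Neps.
- by rewrite ltr0n !muln_gt0 !expn_gt0 p_gt0 (ltnW r_gt1).
- by rewrite ltr0n muln_gt0 muln_gt0 expn_gt0 p_gt0 C_gt0.
exists (maxn 1 D0) => Delta; rewrite geq_max => /andP[Delta_gt0 DeltaD0] T H degH.
have exs : exists s, (Delta <= s ^ (r - 1))%N by exists Delta; rewrite -{1}[Delta]expn1 leq_pexp2l.
have [s Ds smin] := ex_minnP exs => {exs}.
have s_gt0 : (0 < s)%N.
  by rewrite lt0n; apply: contraTneq Ds => ->; rewrite exp0n // -ltnNge.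
have exh : exists h, (0 < h)%N && (C * s <= p ^ (k * h))%N.
  exists (C * s).+1 => //=; apply: leq_trans (ltnW (ltn_expl (C * s) p_gt1)) _.
  by rewrite leq_pexp2l // mulnS; nia.
have [h /andP[h_gt0 Csh] hmin] := ex_minnP exh => {exh}.
have [X [J [cX linJ bigJ noBerge]]] := dense p h pr_p wp h_gt0.
have [|G [col [lab [GH labG bigG]]]] := exists_labelling r_gt1 s_gt0 linJ (leq_trans degH Ds).
  by rewrite cX.
have Gex := ex_number_lower_bound GH (noBerge T G col lab labG).
have count : (#|edges H| * (p ^ h) ^ k.+1 <= p ^ 2 * (2 * r ^ r * r ^ r) * (4 * width) ^ h
    * (p ^ h) ^ (k * (r - 1).+1) * ex_number H (berge_cycle l r))%N.
  have J1 := leq_mul bigJ (leqnn #|edges H|).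
  have J2 := leq_mul (leqnn (p ^ 2 * (4 * width) ^ h)) bigG.
  have J3 := leq_mul (leqnn (p ^ 2 * (4 * width) ^ h * (2 * r ^ r * r ^ r * #|X| ^ r))) Gex.
  have -> : ((p ^ h) ^ k.+1 = p ^ (k * h) * p ^ h)%N.
    by rewrite -expnM mulnS expnD [RHS]mulnC (mulnC k).
  have XE : ((p ^ h) ^ (k * (r - 1).+1) = #|X| ^ r)%N.
    by rewrite cX subn1 prednK ?(ltnW r_gt1) // -!expnM; congr (p ^ _)%N; ring.
  rewrite XE.
  move: J1 J2 J3; move: (p ^ 2)%N (r ^ r)%N (#|X| ^ r)%N ((4 * width) ^ h)%N (p ^ (k * h))%N.
  move: (p ^ h)%N #|J| #|edges H| #|G| (ex_number _ _) => P j n g x a b c d P'.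
  lia.
(* Minimality of [h] keeps the number of points within a factor [p ^ k] of [C * s]. As [h] must be
   positive, [h = 1] is treated apart, by [C * s >= 1]. *)
have size_h : (p ^ (k * h) <= p ^ k * (C * s))%N.
  case: h h_gt0 {Csh cX bigJ count} hmin => // h _ hmin.
  rewrite mulnS expnD leq_mul2l; apply/orP; right; rewrite leqNgt; apply/negP => lt.
  have [h0|h_gt0] := posnP h; first by move: lt; rewrite h0 muln0 expn0 ltnNge muln_gt0 C_gt0 s_gt0.
  by have := hmin h; rewrite h_gt0 (ltnW lt) ltnn => /(_ isT).
apply: (D0P _ DeltaD0 (p ^ h)%:R ((4 * width) ^ h)%:R) => //.
- by rewrite ler1n expn_gt0 p_gt0.
- by rewrite -natrX ler_nat -expnM (mulnC h) expnM leq_exp2r // ltnW.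
- rewrite -natrX -expnM (mulnC h).
  have D1 : 1 <= Delta%:R `^ (r - 1)%:R^-1 :> R.
    apply: le_trans (_ : 1 `^ (r - 1)%:R^-1 <= _); first by rewrite powR1.
    apply: ge0_ler_powR; rewrite ?nnegrE ?invr_ge0 ?ler0n ?ler01 //.
    by rewrite ler1n.
  (* [s] is the root of [Delta] rounded up, which at most doubles it since the root is at least
     [1]. *)
  have s_le : s%:R <= 2 * Delta%:R `^ (r - 1)%:R^-1 :> R.
    clear -smin s_gt0 D1 m_gt0.
    case: s s_gt0 smin => // s _ smin.
    have [->|s_gt0] := posnP s; first by lra.
    have s_t : s%:R <= Delta%:R `^ (r - 1)%:R^-1 :> R.
      have -> : s%:R = (s%:R ^+ (r - 1)) `^ (r - 1)%:R^-1 :> R.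
        by rewrite -powR_mulrn // -powRrM divff ?powRr1 // pnatr_eq0 -lt0n.
      apply: ge0_ler_powR; rewrite ?nnegrE ?invr_ge0 ?exprn_ge0 ?ler0n //.
      rewrite -natrX ler_nat ltnW // ltnNge; apply/negP => /smin; by rewrite ltnn.
    have : 1 <= s%:R :> R by rewrite ler1n.
    rewrite -natr1; move: s_t; move: (Delta%:R `^ _) (s%:R) => t u; lra.
  apply: le_trans (_ : (p ^ k * (C * s))%:R <= _); first by rewrite ler_nat.
  by rewrite mulnA natrM [in leRHS]natrM -[leRHS]mulrA ler_wpM2l ?ler0n.
- by rewrite -!natrX -!natrM ler_nat.
Qed.

Theorem corollary1p2 (R : realType) :
  [/\ forall eps : R, 0 < eps -> exists Delta0 : nat, forall Delta : nat,
        (Delta0 <= Delta)%N ->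
        forall (T : finType) (H : unigraph 3 T), (max_degree H <= Delta)%N ->
        Delta%:R `^ (- (1 / 2) - eps) * #|edges H|%:R
          <= (ex_number H (berge_cycle 3 3))%:R :> R,
      forall eps : R, 0 < eps -> exists Delta0 : nat, forall Delta : nat,
        (Delta0 <= Delta)%N ->
        forall (T : finType) (H : unigraph 3 T), (max_degree H <= Delta)%N ->
        Delta%:R `^ (- (3 / 4) - eps) * #|edges H|%:R
          <= (ex_number H (berge_cycle 4 3))%:R :> R
    & forall eps : R, 0 < eps -> exists Delta0 : nat, forall Delta : nat,
        (Delta0 <= Delta)%N ->
        forall (T : finType) (H : unigraph 4 T), (max_degree H <= Delta)%N ->
        Delta%:R `^ (- (5 / 6) - eps) * #|edges H|%:R
          <= (ex_number H (berge_cycle 4 4))%:R :> R].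
Proof.
have quad r : (1 < r <= 4)%N -> forall p h : nat, prime p -> (width < p)%N -> (0 < h)%N ->
    exists (X : finType) (J : {set {ffun 'I_r -> X}}),
      [/\ #|X| = (p ^ (2 * h))%N, linear_tuples J,
          (p ^ (2 * h) * p ^ h <= p ^ 2 * (4 * width) ^ h * #|J|)%N
        & forall (T : finType) (G : {set {set T}}) col lab, labelling J G col lab ->
          forall (e : 'I_4 -> {set T}) (v : 'I_4 -> T), (forall i, e i \in G) ->
          injective e -> injective v ->
          (forall i, v i \in e i /\ v (ordS i) \in e i) -> False].
  move=> r4 p h pr_p wp h_gt0.
  have [X [J [cX linJ triJ quadJ bigJ]]] := dense_quad_free r4 pr_p wp h_gt0.
  exists X, J; split=> // T G col lab labG e v.
  by case/andP: r4 => _ r4; exact: (labelling_no_berge4 labG linJ triJ quadJ r4).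
split=> eps eps_gt0.
(* The exponent is [1 - 1 / (k * (r - 1))], with [k = 1] for points in the field and [k = 2] for
   points in the plane. *)
- have -> : 1 / 2 = 1 - (1 * (3 - 1))%:R^-1 :> R by rewrite (_ : (1 * (3 - 1) = 2)%N) //; lra.
  apply: relative_turan => // p h pr_p wp h_gt0.
  have [X [J [cX linJ triJ bigJ]]] := dense_triangle_free pr_p wp h_gt0.
  exists X, J; split; rewrite ?mul1n // => T G col lab labG e v.
  exact: (labelling_no_berge3 labG linJ triJ).
- have -> : 3 / 4 = 1 - (2 * (3 - 1))%:R^-1 :> R by rewrite (_ : (2 * (3 - 1) = 4)%N) //; lra.
  by apply: relative_turan => //; exact: quad.
have -> : 5 / 6 = 1 - (2 * (4 - 1))%:R^-1 :> R by rewrite (_ : (2 * (4 - 1) = 6)%N) //; lra.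
by apply: relative_turan => //; exact: quad.
Qed.
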